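(* Let $f:\mathbb{R}\to\mathbb{R}$ be of class $C^{3}$, such that $f$ and $f'=\frac{df}{dx}$ are both non-oscillatory and of very moderate decrease, and such that $f,f',f'',f'''$ are all bounded. For $k\neq 0$ let $$\mathcal{F}(f)(k)=\frac{1}{(2\pi)^{1/2}}\lim_{r\to\infty}\int_{-r}^{r}f(y)e^{-iky}\,dy .$$ Then $\mathcal{F}(f)\in L^{1}(\mathbb{R})$, and for every $x\in\mathbb{R}$, $$f(x)=\mathcal{F}^{-1}(\mathcal{F}(f))(x),$$ where, for $g\in L^{1}(\mathbb{R})$, $$\mathcal{F}^{-1}(g)(x)=\frac{1}{(2\pi)^{1/2}}\int_{-\infty}^{\infty}g(k)e^{ikx}\,dk .$$
   Context: A function $g\in C(\mathbb{R})$ is of very moderate decrease if there is a constant $C>0$ with $|g(x)|\le \frac{C}{|x|}$ for all $|x|>1$. A function $g\in C(\mathbb{R})$ is non-oscillatory if there exist finitely many points $y_1<\dots<y_n$ such that $g$ is monotone on each $(y_i,y_{i+1})$, $1\le i\le n-1$, and on $(-\infty,y_1)$ and $(y_n,\infty)$. Monotone means weakly monotone. The function $\mathcal{F}(f)$ is defined for $k\ne 0$ by the displayed limit. *)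

(* Defs.v *)
From HB Require Import structures.
From mathcomp Require Import all_boot all_order all_algebra.
From mathcomp Require Import all_classical all_reals all_analysis.
From mathcomp Require Import complex.

Set Implicit Arguments.
Unset Strict Implicit.
Unset Printing Implicit Defensive.

Import Order.TTheory GRing.Theory Num.Theory.
Import numFieldNormedType.Exports.

Local Open Scope classical_set_scope.
Local Open Scope ring_scope.
Local Open Scope complex_scope.

Definition very_moderate_decrease (R : realType) (g : R -> R) : Prop :=
  continuous g /\
  exists2 C : R, 0 < C & forall x, 1 < `|x| -> `|g x| <= C / `|x|.

Definition monotone_on (R : realType) (i : interval R) (g : R -> R) : Prop :=
  {in i &, nondecreasing_fun g} \/ {in i &, nonincreasing_fun g}.

Definition non_oscillatory (R : realType) (g : R -> R) : Prop :=
  continuous g /\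
  exists ys : seq R,
    [/\ (0 < size ys)%N /\ sorted <%R ys,
        forall i, (i.+1 < size ys)%N -> monotone_on `]ys`_i, ys`_i.+1[ g,
        monotone_on `]-oo, ys`_0[ g
      & monotone_on `]ys`_(size ys).-1, +oo[ g].

Definition class_C (R : realType) (n : nat) (f : R -> R) : Prop :=
  (forall i, (i < n)%N -> forall x, derivable (f^`(i)%classic) x 1) /\
  continuous (f^`(n)%classic).

Definition cexp (R : realType) (z : R[i]) : R[i] :=
  (expR (complex.Re z))%:C *
  (cos (complex.Im z) +i* sin (complex.Im z)).

(* Lebesgue integral of a complex-valued function; meaningful when g is
   integrable on D. *)
Definition cintegral (R : realType) (D : set R) (g : R -> R[i]) : R[i] :=
  (\int[lebesgue_measure]_(x in D) complex.Re (g x)) +i*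
  (\int[lebesgue_measure]_(x in D) complex.Im (g x)).

Definition L1 (R : realType) (g : R -> R[i]) : Prop :=
  [/\ measurable_fun [set: R] (fun x => complex.Re (g x)),
      measurable_fun [set: R] (fun x => complex.Im (g x))
    & (\int[lebesgue_measure]_x (ComplexField.Normc.normc (g x))%:E < +oo)%E].

(* The regular algebra R[i]^o is where the library puts the topology of the
   modulus on R[i]. *)
Definition truncated_fourier (R : realType) (f : R -> R) (k r : R) : R[i]^o :=
  cintegral `[- r, r] (fun y => (f y)%:C * cexp (- ('i%C * k%:C * y%:C))).

(* Only the values at k != 0 matter: when the limit does not exist at k = 0,
   [lim] returns an arbitrary value there, on a null set. *)
Definition fourier (R : realType) (f : R -> R) (k : R) : R[i] :=
  ((Num.sqrt (2 * pi))^-1)%:C * lim (truncated_fourier f k r @[r --> +oo]).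

Definition inverse_fourier (R : realType) (g : R -> R[i]) (x : R) : R[i] :=
  ((Num.sqrt (2 * pi))^-1)%:C *
  cintegral setT (fun k => g k * cexp ('i%C * k%:C * x%:C)).

(* Main.v *)
(** Integrating by parts twice, and using that [f] and [f'] are eventually
    monotone so that their derivatives have finite integral of absolute value,
    bounds [F(f)(k)] by a multiple of [k ^- 2].  Near [0], splitting the
    integral at [|y| = |k| ^ (-1/2)] bounds it by a multiple of [|k| ^
      (-1/2)], since the
    tail beyond [A] is [O(1 / (A |k|))].  Both bounds hold for the truncated
    integrals over [[-r, r]] damped by [expR (- k / r)], uniformly in [r], so
    dominated convergence applies to the integral in [k]; exchanging the two
    integrals turns the damping into the Poisson kernel of width [1 / r], whose
    averages of [f] around [x] tend to [pi * f x]. *)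
Require Import Defs.
From HB Require Import structures.
From mathcomp Require Import all_boot all_order all_algebra.
From mathcomp Require Import all_classical all_reals all_analysis.
From mathcomp Require Import measurable_realfun complex.
From mathcomp Require Import ring lra.

Set Implicit Arguments.
Unset Strict Implicit.
Unset Printing Implicit Defensive.

Import Order.TTheory GRing.Theory Num.Theory.
Import numFieldNormedType.Exports.

Local Open Scope classical_set_scope.
Local Open Scope ring_scope.
Local Open Scope complex_scope.

(** * Integrals over segments *)

(** The decay [O(1 / |y|)] does not make [f] integrable, so the double integral over [k] and [y]
    need not converge absolutely and cannot be exchanged as it stands. One parameter [r] therefore
    cuts off [y], damps [k] and sets the kernel width at once: each exchange takes place on a
    compact rectangle and a single limit remains. All estimates concern real integrals over [k > 0].
    Multiplying by [e^(ikx)] shifts the phase of the cosine by [- k * x]. As functions of [k], the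
    real part of [F(f)(k) e^(ikx)] is even and its imaginary part odd, so the latter integrates to
    [0] and the former to twice a half-line integral; twice the Poisson mass [pi] is the [2 * pi] of
    the normalisation. *)

Section segment_integrals.
Variable R : realType.
Implicit Types (f g h : R -> R) (a b c k t x y M : R).
Local Notation mu := (@lebesgue_measure R).

Lemma is_derive_continuous f g :
  (forall x, is_derive x 1 f (g x)) -> continuous f.
Proof.
move=> df x; apply: differentiable_continuous; apply/derivable1_diffP.
by have [] := df x.
Qed.

Lemma continuous_integrable_itv f a b :
  continuous f -> mu.-integrable `[a, b] (EFin \o f).
Proof.
move=> cf; apply: continuous_compact_integrable; first exact: segment_compact.
exact: continuous_subspaceT.
Qed.

Lemma continuous_norm f : continuous f -> continuous (fun x => `|f x|).
Proof. by move=> cf x; apply: cvg_norm; exact: cf. Qed.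

Lemma continuous_funM f g : continuous f -> continuous g ->
  continuous (fun x => f x * g x).
Proof. by move=> cf cg x; apply: cvgM; [exact: cf|exact: cg]. Qed.

Lemma continuous_wave k t : continuous (fun y => cos (k * y + t)).
Proof.
apply: (@is_derive_continuous _ (fun y => - sin (k * y + t) * k)) => x.
by apply: is_derive_eq; rewrite /GRing.scale /= mulr1 addr0.
Qed.

Lemma Rintegral_itv_FTC f g a b : a <= b -> continuous g ->
  (forall x, is_derive x 1 f (g x)) ->
  \int[mu]_(x in `[a, b]) g x = f b - f a.
Proof.
rewrite le_eqVlt => /predU1P[<- _ _|ab cg dfg].
  by rewrite set_itv1 Rintegral_set1 subrr.
have cf := is_derive_continuous dfg.
rewrite /Rintegral (continuous_FTC2 (F := f) ab).
- by [].
- exact: continuous_subspaceT.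
- split.
  + by move=> x _; have [] := dfg x.
  + exact/cvg_at_right_filter/cf.
  + exact/cvg_at_left_filter/cf.
- by move=> x _; rewrite derive1E; have [] := dfg x.
Qed.

Lemma Rintegral_itvD f a b c : a <= b -> b <= c -> continuous f ->
  \int[mu]_(x in `[a, c]) f x =
  \int[mu]_(x in `[a, b]) f x + \int[mu]_(x in `[b, c]) f x.
Proof.
move=> ab bc cf; apply/eqP; rewrite addrC -subr_eq; apply/eqP.
rewrite Rintegral_itvB ?bnd_simp//; last exact: continuous_integrable_itv.
rewrite Rintegral_itv_obnd_cbnd//.
apply: integrableS (continuous_integrable_itv b c cf) => //.
exact: subset_itv_oc_cc.
Qed.

Lemma Rintegral_itv_le f g a b : continuous f -> continuous g ->
  (forall x, a <= x <= b -> f x <= g x) ->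
  \int[mu]_(x in `[a, b]) f x <= \int[mu]_(x in `[a, b]) g x.
Proof.
move=> cf cg fg; apply: le_Rintegral => //;
  try exact: continuous_integrable_itv.
Qed.

Lemma Rintegral_itv_cst M a b : a <= b ->
  \int[mu]_(x in `[a, b]) M = M * (b - a).
Proof.
move=> ab; have dF x : is_derive x 1 (fun x => M * x) M.
  by apply: is_derive_eq; rewrite /GRing.scale /= mulr1.
by rewrite (Rintegral_itv_FTC ab (@cst_continuous _ _ _) dF) mulrBr.
Qed.

Lemma le_Rintegral_itv_norm f g a b : continuous f -> continuous g ->
  (forall x, a <= x <= b -> `|f x| <= g x) ->
  `|\int[mu]_(x in `[a, b]) f x| <= \int[mu]_(x in `[a, b]) g x.
Proof.
move=> cf cg fg.
apply: (le_trans (le_normr_Rintegral _ _)) => //.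
  exact: continuous_integrable_itv.
exact: Rintegral_itv_le (continuous_norm cf) cg fg.
Qed.

Lemma Rintegral_itv_bound f M a b : a <= b -> continuous f ->
  (forall x, a <= x <= b -> `|f x| <= M) ->
  `|\int[mu]_(x in `[a, b]) f x| <= M * (b - a).
Proof.
move=> ab cf fM; rewrite -Rintegral_itv_cst//.
exact: le_Rintegral_itv_norm cf (@cst_continuous _ _ _) fM.
Qed.

Lemma Rintegral_itv_opp f a b : a <= b -> continuous f ->
  \int[mu]_(x in `[- b, - a]) f x = \int[mu]_(x in `[a, b]) f (- x).
Proof.
move=> ab cf; rewrite /Rintegral integration_by_substitution_oppr//.
exact: continuous_subspaceT.
Qed.

(** [decr_derive1_le0] asks for strict decrease whereas [f] is only weakly monotone: adding a slope
    [e] and changing sign makes it strict, and [e] is arbitrarily small. *)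
Lemma nondecreasing_derive_ge0 f g a x :
  (forall y, is_derive y 1 f (g y)) -> {in `]a, +oo[ &, nondecreasing_fun f} ->
  a < x -> 0 <= g x.
Proof.
move=> df ndf ax; apply/ler_addgt0Pr => e e0; rewrite -oppr_le0.
have dh y : is_derive y 1 (fun z => - (f z + e * z)) (- (g y + e)).
  by apply: is_derive_eq; rewrite /GRing.scale /= mulr1.
have -> : - (g x + e) = ((fun z => - (f z + e * z))^`()%classic) x.
  by rewrite derive1E; have [_ ->] := dh x.
apply: (@decr_derive1_le0 _ _ [set` `]a, +oo[]).
- by move=> y _; have [] := dh y.
- move=> y z; rewrite !inE => ya za yz; rewrite ltrN2 ler_ltD ?ltr_pM2l//.
  exact/ndf/ltW.
- by rewrite interior_itv/= in_itv/= ax.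
Qed.

(** Past [Y] the derivative keeps one sign, so the absolute value leaves the integral. Eventual
    monotonicity enters the estimates here. *)
Lemma Rintegral_norm_derive_monotone f g Y a b : Y < a -> a <= b ->
  continuous g -> (forall y, is_derive y 1 f (g y)) ->
  monotone_on `]Y, +oo[ f ->
  \int[mu]_(x in `[a, b]) `|g x| = `|f b - f a|.
Proof.
wlog ndf : f g / {in `]Y, +oo[ &, nondecreasing_fun f} => [wlg|].
  move=> Ya ab cg df [ndf|nif]; first by apply: wlg => //; left.
  have H : {in `]Y, +oo[ &, nondecreasing_fun (- f)}.
    by move=> x y xY yY xy; rewrite lerN2; exact: nif.
  rewrite -normrN opprB addrC -[f a]opprK -[RHS]/(`|(- f) b - (- f) a|).
  rewrite -(wlg _ (fun x => - g x) H)//.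
  - by under [RHS]eq_Rintegral do rewrite normrN.
  - by move=> x; apply: cvgN; exact: cg.
  - by left.
move=> Ya ab cg df _.
have g0 x : a <= x -> 0 <= g x.
  by move=> ax; apply: nondecreasing_derive_ge0 df ndf _; exact: lt_le_trans ax.
rewrite -(Rintegral_itv_FTC ab cg df) ger0_norm; last first.
  by apply: Rintegral_ge0 => x /=; rewrite in_itv/= => /andP[/g0].
by apply: eq_Rintegral => x; rewrite inE/= in_itv/= => /andP[/g0/ger0_norm].
Qed.

End segment_integrals.

(** * Oscillating integrals *)

Section oscillating_integrals.
Variable R : realType.
Implicit Types (f g h : R -> R) (a b k t x y A M : R).
Local Notation mu := (@lebesgue_measure R).

(* At phase [t = pi / 2] the cosine becomes [- sin]: the phase lets one family
   carry both the real and the imaginary part of the Fourier integral. *)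
Definition wave f k t a b := \int[mu]_(y in `[a, b]) (f y * cos (k * y + t)).

Lemma continuous_mul_wave f k t : continuous f ->
  continuous (fun y => f y * cos (k * y + t)).
Proof. by move=> cf; apply: continuous_funM => //; exact: continuous_wave. Qed.

Lemma norm_mul_cos_le x y : `|x * cos y| <= `|x|.
Proof.
rewrite normrM -[leRHS]mulr1; apply: ler_wpM2l => //.
by rewrite ler_norml cos_geN1 cos_le1.
Qed.

Lemma norm_mul_sin_le x y : `|x * sin y| <= `|x|.
Proof.
rewrite normrM -[leRHS]mulr1; apply: ler_wpM2l => //.
by rewrite ler_norml sin_geN1 sin_le1.
Qed.

Lemma waveD f k t a b c : a <= b -> b <= c -> continuous f ->
  wave f k t a c = wave f k t a b + wave f k t b c.
Proof. by move=> ab bc cf; apply: Rintegral_itvD => //;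
  exact: continuous_mul_wave. Qed.

Lemma wave_opp f k t a b : a <= b -> continuous f ->
  wave f k t (- b) (- a) = wave (fun y => f (- y)) (- k) t a b.
Proof.
move=> ab cf; rewrite /wave Rintegral_itv_opp//;
  last exact: continuous_mul_wave.
by under eq_Rintegral do rewrite mulrN -mulNr.
Qed.

Lemma wave_le f k t a b : continuous f ->
  `|wave f k t a b| <= \int[mu]_(y in `[a, b]) `|f y|.
Proof.
move=> cf; apply: le_Rintegral_itv_norm.
- exact: continuous_mul_wave.
- exact: continuous_norm.
- by move=> x _; exact: norm_mul_cos_le.
Qed.

Lemma wave_bound f k t a b M : a <= b -> continuous f ->
  (forall x, a <= x <= b -> `|f x| <= M) -> `|wave f k t a b| <= M * (b - a).
Proof.
move=> ab cf fM; apply: Rintegral_itv_bound => //.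
  exact: continuous_mul_wave.
by move=> x xab; rewrite (le_trans (norm_mul_cos_le _ _))// fM.
Qed.

(** The sine produced by integration is a cosine at phase [t - pi / 2], so the remaining integral is
    again a [wave] and the step can be repeated on [g]. *)
Lemma wave_by_parts f g k t a b : a <= b -> k != 0 -> continuous g ->
  (forall x, is_derive x 1 f (g x)) ->
  wave f k t a b = (f b * sin (k * b + t) - f a * sin (k * a + t)) / k
    - wave g k (t - pi / 2) a b / k.
Proof.
move=> ab k0 cg df; have cf := is_derive_continuous df.
pose F y := f y * sin (k * y + t) / k.
pose h y := f y * cos (k * y + t) + k^-1 * (g y * cos (k * y + (t - pi / 2))).
have dF x : is_derive x 1 F (h x).
  rewrite /h addrA cosB cos_pihalf sin_pihalf mulr0 mulr1 add0r.
  by apply: is_derive_eq; rewrite /GRing.scale /= mulr1 addr0; field.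
have ch : continuous h.
  move=> x; apply: cvgD; first exact: continuous_mul_wave.
  by apply: cvgM; [exact: cvg_cst|exact: continuous_mul_wave].
have := Rintegral_itv_FTC ab ch dF.
have i1 := continuous_integrable_itv a b (continuous_mul_wave (k:=k) (t:=t) cf).
have i2 := continuous_integrable_itv a b
  (continuous_mul_wave (k:=k) (t:=t - pi / 2) cg).
rewrite RintegralD//; last first.
  by apply: continuous_integrable_itv => x; apply: cvgM;
    [exact: cvg_cst|exact: continuous_mul_wave].
rewrite RintegralZl// -!/(wave _ _ _ _ _) /F => E.
by rewrite mulrBl -E; ring.
Qed.

Lemma wave_by_parts_le f g k t a b : a <= b -> k != 0 -> continuous g ->
  (forall x, is_derive x 1 f (g x)) ->
  `|wave f k t a b| <=
    (`|f a| + `|f b| + \int[mu]_(y in `[a, b]) `|g y|) / `|k|.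
Proof.
move=> ab k0 cg df; rewrite (wave_by_parts t ab k0 cg df) -mulrBl normrM normfV.
apply: ler_wpM2r; first by rewrite invr_ge0.
rewrite (le_trans (ler_normB _ _))// lerD//; last exact: wave_le.
rewrite (le_trans (ler_normB _ _))// addrC lerD//; exact: norm_mul_sin_le.
Qed.

(* Only the behaviour at [+oo] is controlled; [bitame] adds [-oo] by reflection.
   The factor [1 + |x|] encodes boundedness and [O(1 / |x|)] decay at once. *)
Definition tame f g :=
  [/\ forall x, is_derive x 1 f (g x), continuous g,
      exists M : R, forall x, `|g x| <= M,
      exists C : R, forall x, (1 + `|x|) * `|f x| <= C
    & exists Y, monotone_on `]Y, +oo[ f].

Lemma tame_continuous f g : tame f g -> continuous f.
Proof. by case=> df _ _ _ _; exact: is_derive_continuous df. Qed.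

Lemma decay_le f C x A : (forall x, (1 + `|x|) * `|f x| <= C) ->
  0 < A -> A <= `|x| -> `|f x| <= C / A.
Proof.
move=> fC A0 Ax; rewrite ler_pdivlMr// (le_trans _ (fC x))// mulrC.
by apply: ler_wpM2r => //; rewrite (le_trans Ax)// lerDr.
Qed.

(** Far out, monotonicity and decay bound the variation by two values of [f]; on the compact part
    before that, the bound on [g] suffices. The constant serves every [A > 0], because small [k]
    will place the cut far out and larger [k] close to [0]. *)
Lemma tame_variation f g : tame f g ->
  exists2 C : R, 0 <= C & forall A b, 0 < A -> A <= b ->
    \int[mu]_(y in `[A, b]) `|g y| <= C / A.
Proof.
move=> [df cg [M gM] [C fC] [Y mf]]; have cng := continuous_norm cg.
have M0 : 0 <= M by apply: le_trans (gM 0).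
have C0 : 0 <= C by apply: le_trans (fC 0); rewrite mulr_ge0// addr_ge0.
pose Z : R := `|Y| + 1.
have Z0 : 0 < Z by rewrite /Z ltr_wpDl.
have YZ : Y < Z by rewrite (le_lt_trans (ler_norm _))// ltrDl.
have far a b : Z <= a -> a <= b -> \int[mu]_(y in `[a, b]) `|g y| <= 2 * C / a.
  move=> Za ab; have a0 : 0 < a by exact: lt_le_trans Za.
  rewrite (Rintegral_norm_derive_monotone (Y := Y) (f := f))//;
    last exact: lt_le_trans Za.
  rewrite (le_trans (ler_normB _ _))// mulr2n mulrDl mul1r mulrDl.
  by rewrite lerD// (decay_le fC)// ger0_norm// ltW// (lt_le_trans a0).
(* Here [b - a <= Z] and [a <= Z], so the crude bound [M * (b - a)] takes the same form, a constant
   over [a], as the far one. *)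
have near a b : 0 < a -> a <= b -> b <= Z ->
    \int[mu]_(y in `[a, b]) `|g y| <= M * Z ^+ 2 / a.
  move=> a0 ab bZ; rewrite (le_trans (ler_norm _))//.
  have := @Rintegral_itv_bound _ _ M _ _ ab cng.
  move=> /(_ _)/le_trans; apply => [x _|]; first by rewrite normr_id.
  rewrite ler_pdivlMr// -mulrA ler_wpM2l// expr2 ler_pM ?subr_ge0//.
  - exact: ltW.
  - by rewrite (le_trans _ bZ)// gerBl ltW.
  - exact: le_trans bZ.
exists (M * Z ^+ 2 + 2 * C).
  by rewrite addr_ge0 ?mulr_ge0// ltW.
have MZ : 0 <= M * Z ^+ 2 by rewrite !mulr_ge0// ltW.
move=> A b A0 Ab; rewrite mulrDl.
have [ZA|AZ] := leP Z A.
  by rewrite (le_trans (far _ _ ZA Ab))// lerDr divr_ge0// ltW.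
have [bZ|Zb] := leP b Z.
  by rewrite (le_trans (near _ _ A0 Ab bZ))// lerDl divr_ge0 ?mulr_ge0// ltW.
rewrite (Rintegral_itvD (ltW AZ) (ltW Zb) cng) lerD//.
  by apply: near => //; exact: ltW.
rewrite (le_trans (far _ _ _ (ltW Zb)))//.
by apply: ler_wpM2l; [rewrite mulr_ge0|rewrite lef_pV2// ltW].
Qed.

(** After one integration by parts, the two boundary values and the variation of [f] are each
    [O(1 / A)]. [K] is independent of [b], which gives a Cauchy criterion, and of [t], which will
    later vary with [k]. *)
Lemma tame_wave_tail f g : tame f g ->
  exists2 K : R, 0 <= K & forall k t A b, k != 0 -> 0 < A -> A <= b ->
    `|wave f k t A b| <= K / (A * `|k|).
Proof.
move=> tf; have [df cg _ [C fC] _] := tf.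
have C0 : 0 <= C by apply: le_trans (fC 0); rewrite mulr_ge0// addr_ge0.
have [V V0 gV] := tame_variation tf.
exists (C + C + V); first by rewrite !addr_ge0.
move=> k t A b k0 A0 Ab; rewrite (le_trans (wave_by_parts_le _ Ab k0 cg df))//.
rewrite invfM mulrA; apply: ler_wpM2r; first by rewrite invr_ge0.
rewrite !mulrDl !lerD ?gV//; apply: (decay_le fC) => //.
  by rewrite ger0_norm// ltW.
by rewrite ger0_norm// ltW// (lt_le_trans A0).
Qed.

Definition bitame f g :=
  tame f g /\ tame (fun x => f (- x)) (fun x => - g (- x)).

(** The two outer pieces are a tail of [f] and, after reflection, a tail of [f (- x)] at frequency
    [- k]. This yields both the convergence in [r] and the bound for small [|k|]. *)
Lemma bitame_wave_cauchy f g : bitame f g ->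
  exists2 K : R, 0 <= K & forall k t A b, k != 0 -> 0 < A -> A <= b ->
    `|wave f k t (- b) b - wave f k t (- A) A| <= K / (A * `|k|).
Proof.
move=> [tf tf']; have cf := tame_continuous tf.
have [K K0 HK] := tame_wave_tail tf; have [L L0 HL] := tame_wave_tail tf'.
exists (L + K); first exact: addr_ge0.
move=> k t A b k0 A0 Ab.
have AA : - A <= A by rewrite ge0_cp// ltW.
rewrite (@waveD _ _ _ (- b) (- A) b) ?lerN2//; last exact: le_trans Ab.
rewrite (@waveD _ _ _ (- A) A b)// wave_opp//.
rewrite addrCA (addrC (wave _ _ _ (- A) A)) addrK mulrDl (le_trans
  (ler_normD _ _))// lerD//.
  by rewrite -[`|k|]normrN HL// oppr_eq0.
exact: HK.
Qed.
End oscillating_integrals.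

(** * Improper oscillating integrals and their bounds in the frequency *)

Section improper_wave.
Variable R : realType.
Implicit Types (f g h : R -> R) (a b k r t x y A M : R).
Local Notation mu := (@lebesgue_measure R).

(* Comparable to the minimum of [x ^- (1/2)] and [x ^- 2], and the derivative of
   [2 * atan (Num.sqrt x)]. *)
Definition profile x : R := (Num.sqrt x * (1 + x))^-1.

Lemma profile_ge0 x : 0 <= x -> 0 <= profile x.
Proof. by move=> x0; rewrite invr_ge0 mulr_ge0 ?sqrtr_ge0// addr_ge0. Qed.

(** The factor [2] comes from [1 + x <= 2] when [x <= 1], and from
    [Num.sqrt x * (1 + x) <= x * (2 * x)] when [x > 1]. *)
Lemma le_profile K x y : 0 < x -> 0 <= K ->
  y <= K / Num.sqrt x -> y <= K / x ^+ 2 -> y <= 2 * K * profile x.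
Proof.
move=> x0 K0 y1 y2; rewrite /profile.
have s0 : 0 < Num.sqrt x by rewrite sqrtr_gt0.
have x10 : 0 < 1 + x by rewrite addr_gt0.
have [x1|x1] := leP x 1.
  rewrite (le_trans y1)//.
  have -> : 2 * K / (Num.sqrt x * (1 + x)) = K / Num.sqrt x * (2 / (1 + x)).
    by field; rewrite !gt_eqF.
  rewrite ler_peMr ?divr_ge0 ?sqrtr_ge0//.
  by rewrite ler_pdivlMr ?mul1r//; lra.
rewrite (le_trans y2)// mulrAC mulrC ler_wpM2r//.
rewrite ler_pdivlMr ?mulr_gt0// mulrC ler_pdivrMr ?exprn_gt0//.
have sx : Num.sqrt x <= x.
  by rewrite -{2}(sqr_sqrtr (ltW x0)) expr2 ler_peMr ?ltW// -sqrtr1 ltr_sqrt.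
have x2 : 1 + x <= 2 * x by lra.
by have := ler_pM (ltW s0) (ltW x10) sx x2; rewrite mulrCA expr2.
Qed.

Lemma wave_le_sqrt f g : bitame f g ->
  exists2 K : R, 0 <= K & forall k t r, k != 0 -> 0 < r ->
    `|wave f k t (- r) r| <= K / Num.sqrt `|k|.
Proof.
move=> tf; have [K K0 HK] := bitame_wave_cauchy tf.
have [tf1 _] := tf; have cf := tame_continuous tf1.
have [_ _ _ [C fC] _] := tf1.
have fC' x : `|f x| <= C.
  by rewrite (le_trans _ (fC x))// ler_peMl// lerDl.
have C0 : 0 <= C by exact: le_trans (fC' 0).
have small k t r : 0 < r -> `|wave f k t (- r) r| <= 2 * C * r.
  move=> r0; rewrite (le_trans (@wave_bound _ f k t _ _ C _ cf _))//.
    by rewrite ge0_cp// ltW.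
  by rewrite le_eqVlt; apply/orP; left; apply/eqP; ring.
exists (2 * C + K); first by rewrite addr_ge0// mulr_ge0.
move=> k t r k0 r0.
have s0 : 0 < Num.sqrt `|k| by rewrite sqrtr_gt0 normr_gt0.
have A0 : 0 < (Num.sqrt `|k|)^-1 by rewrite invr_gt0.
have [rA|Ar] := leP r (Num.sqrt `|k|)^-1.
  rewrite (le_trans (small _ _ _ r0))// [(_ + K) / _]mulrDl ler_wpDr//.
    by rewrite divr_ge0// ltW.
  by rewrite ler_wpM2l// mulr_ge0.
rewrite -[X in `|X|](subrK (wave f k t (- (Num.sqrt `|k|)^-1)
  (Num.sqrt `|k|)^-1)).
rewrite (le_trans (ler_normD _ _))// addrC [(_ + K) / _]mulrDl lerD//;
  first exact: small.
rewrite (le_trans (HK k t _ _ k0 A0 (ltW Ar)))//.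
rewrite -{2}[`|k|]sqr_sqrtr ?normr_ge0// expr2 mulKf//.
by rewrite gt_eqF.
Qed.

(** Two tails beyond [1] and the bound of [g] on [[-1, 1]]. Applied to the first derivative, it
    bounds the integral of the absolute value of the second. *)
Lemma bitame_variation f g : bitame f g ->
  exists2 W : R, 0 <= W &
    forall r, 1 <= r -> \int[mu]_(y in `[- r, r]) `|g y| <= W.
Proof.
move=> [tf tf']; have [L L0 HL] := tame_variation tf.
have [L' L'0 HL'] := tame_variation tf'.
have [_ cg [M gM] _ _] := tf; have cng := continuous_norm cg.
have M0 : 0 <= M by exact: le_trans (gM 0).
exists (L' + M * (1 - - 1) + L) => [|r r1].
  by rewrite !addr_ge0// mulr_ge0// opprK.
rewrite (@Rintegral_itvD _ _ (- r) 1 r)//; last lra.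
rewrite (@Rintegral_itvD _ _ (- r) (- 1) 1)//; last lra.
rewrite !lerD//.
- rewrite Rintegral_itv_opp//.
  under eq_Rintegral do rewrite -normrN.
  by rewrite (le_trans (HL' _ _ _ r1))// divr1.
- rewrite (le_trans (ler_norm _))//; apply: Rintegral_itv_bound => //.
  by move=> x _; rewrite normr_id.
- by rewrite (le_trans (HL _ _ _ r1))// divr1.
Qed.

(** The boundary terms of the first integration by parts carry only one power of [1 / |k|] and are
    small through [f (r)] and [f (- r)], hence the separate summand, which vanishes as [r] grows.
    Those of the second already carry [k ^- 2], so boundedness of [g] is enough. *)
Lemma wave_le_square f g h : bitame f g -> bitame g h ->
  exists2 K : R, 0 <= K & forall k t r, k != 0 -> 1 <= r ->
    `|wave f k t (- r) r| <= K / (r * `|k|) + K / `|k| ^+ 2.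
Proof.
move=> [tf tf'] tg; have [df cg [M gM] [C fC] _] := tf.
have [W W0 hW] := bitame_variation tg.
have [[dg ch _ _ _] _] := tg.
have C0 : 0 <= C by apply: le_trans (fC 0); rewrite mulr_ge0// addr_ge0.
have M0 : 0 <= M by exact: le_trans (gM 0).
exists (2 * C + (2 * M + W)); first by rewrite !addr_ge0// mulr_ge0.
move=> k t r k0 r1; have r0 : 0 < r by rewrite (lt_le_trans _ r1).
have nk0 : 0 < `|k| by rewrite normr_gt0.
have rr : - r <= r by rewrite ge0_cp// ltW.
rewrite (wave_by_parts t rr k0 cg df) (le_trans (ler_normB _ _))// lerD//.
  rewrite normrM normfV invfM mulrA ler_pM2r ?invr_gt0//.
  apply: (@le_trans _ _ (2 * C / r)).
    rewrite (le_trans (ler_normB _ _))// mulr2n mulrDl mul1r mulrDl lerD//.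
      rewrite (le_trans (norm_mul_sin_le _ _))// (decay_le fC)//.
      by rewrite ger0_norm// ltW.
    rewrite (le_trans (norm_mul_sin_le _ _))// (decay_le fC)//.
    by rewrite normrN ger0_norm// ltW.
  by rewrite ler_pM2r ?invr_gt0// lerDl addr_ge0// mulr_ge0.
rewrite normrM normfV expr2 invfM mulrA ler_pM2r ?invr_gt0//.
rewrite (le_trans (wave_by_parts_le _ rr k0 ch dg))// ler_pM2r ?invr_gt0//.
rewrite ler_wpDl ?mulr_ge0// lerD ?hW// mulr2n mulrDl mul1r.
by rewrite lerD.
Qed.

Lemma wave_is_cvg f g k t : bitame f g -> k != 0 ->
  cvg (wave f k t (- r) r @[r --> +oo]).
Proof.
move=> tf k0; have [K K0 HK] := bitame_wave_cauchy tf.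
have nk0 : 0 < `|k| by rewrite normr_gt0.
apply/cauchy_cvgP; apply: cauchy_exP => e /= e0.
(* At this cut the Cauchy bound [K / (A * |k|)] equals [K * e / (K + 1) < e]; the [+ 1] keeps the
   cut positive when [K = 0]. *)
have A0 : 0 < (K + 1) / (e * `|k|) by rewrite divr_gt0 ?mulr_gt0// ltr_wpDl.
exists (wave f k t (- ((K + 1) / (e * `|k|))) ((K + 1) / (e * `|k|))).
near=> r.
have Ar : (K + 1) / (e * `|k|) <= r.
  by near: r; apply: nbhs_pinfty_ge; exact: num_real.
rewrite /ball/= distrC (le_lt_trans (HK _ _ _ _ k0 A0 Ar))//.
have -> : (K + 1) / (e * `|k|) * `|k| = (K + 1) / e.
  by field; rewrite !gt_eqF.
by rewrite invf_div mulrA ltr_pdivrMr ?ltr_wpDl// mulrC ltr_pM2l// ltrDl.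
Unshelve. all: by end_near. Qed.

Definition improper_wave f k t : R := lim (wave f k t (- r) r @[r --> +oo]).

Lemma wave_cvg f g k t : bitame f g -> k != 0 ->
  wave f k t (- r) r @[r --> +oo] --> improper_wave f k t.
Proof. by move=> tf k0; apply: wave_is_cvg tf _. Qed.

Lemma improper_wave_le_sqrt f g : bitame f g ->
  exists2 K : R, 0 <= K & forall k t, k != 0 ->
    `|improper_wave f k t| <= K / Num.sqrt `|k|.
Proof.
move=> tf; have [K K0 HK] := wave_le_sqrt tf; exists K => // k t k0.
apply: (cvgr_to_le (cvg_norm (wave_cvg (t := t) tf k0))).
near=> r; apply: HK => //; near: r; apply: nbhs_pinfty_gt; exact: num_real.
Unshelve. all: by end_near. Qed.

Lemma improper_wave_le_square f g h : bitame f g -> bitame g h ->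
  exists2 K : R, 0 <= K & forall k t, k != 0 ->
    `|improper_wave f k t| <= K / `|k| ^+ 2.
Proof.
move=> tf tg; have [K K0 HK] := wave_le_square tf tg; exists K => // k t k0.
have nk0 : 0 < `|k| by rewrite normr_gt0.
apply/ler_addgt0Pl => e e0.
apply: (cvgr_to_le (cvg_norm (wave_cvg (t := t) tf k0))).
near=> r.
have r1 : 1 <= r by near: r; apply: nbhs_pinfty_ge; exact: num_real.
rewrite (le_trans (HK _ _ _ k0 r1))// lerD2r.
rewrite invfM mulrA mulrAC ler_pdivrMr; last by rewrite (lt_le_trans _ r1).
rewrite -ler_pdivrMl//.
Unshelve. all: by end_near. Qed.

Lemma improper_wave_le_profile f g h : bitame f g -> bitame g h ->
  exists2 K : R, 0 <= K & forall k t, k != 0 ->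
    `|improper_wave f k t| <= K * profile `|k|.
Proof.
move=> tf tg; have [K K0 HK] := improper_wave_le_sqrt tf.
have [L L0 HL] := improper_wave_le_square tf tg.
exists (2 * (K + L)); first by rewrite mulr_ge0// addr_ge0.
move=> k t k0; have nk0 : 0 < `|k| by rewrite normr_gt0.
apply: le_profile => //; first exact: addr_ge0.
  rewrite (le_trans (HK _ _ k0))// ler_wpM2r ?invr_ge0 ?sqrtr_ge0// lerDl//.
rewrite (le_trans (HL _ _ k0))// ler_wpM2r ?invr_ge0 ?exprn_ge0// lerDr//.
Qed.

(* The boundary term [1 / (r k)] of [wave_le_square] is absorbed by the
   damping, because [u * expR (- u) <= 1] at [u = k / r]. *)
Lemma damped_wave_le_profile f g h : bitame f g -> bitame g h ->
  exists2 K : R, 0 <= K & forall k t r, 0 < k -> 1 <= r ->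
    `|expR (- (k / r)) * wave f k t (- r) r| <= K * profile k.
Proof.
move=> tf tg; have [K K0 HK] := wave_le_sqrt tf.
have [L L0 HL] := wave_le_square tf tg.
(* One [L] pays for the damped boundary term, the other for the [k ^- 2] term; the outer [2] is that
   of [le_profile]. *)
exists (2 * (K + 2 * L)); first by rewrite mulr_ge0// addr_ge0// mulr_ge0.
move=> k t r k0 r1; have r0 : 0 < r by rewrite (lt_le_trans _ r1).
have kN0 : k != 0 by rewrite gt_eqF.
have kr0 : 0 < k / r by rewrite divr_gt0.
have E1 : expR (- (k / r)) <= 1 by rewrite -expR0 ler_expR oppr_le0 ltW.
have E2 : expR (- (k / r)) <= (k / r)^-1.
  rewrite expRN lef_pV2 ?posrE ?expR_gt0// (le_trans _ (expR_ge1Dx _))//.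
  by rewrite lerDr.
have nE : `|expR (- (k / r))| = expR (- (k / r)).
  by rewrite ger0_norm// expR_ge0.
have LL : 0 <= 2 * L by rewrite mulr_ge0.
have nk : `|k| = k by rewrite gtr0_norm.
apply: le_profile => //; first exact: addr_ge0.
  rewrite normrM nE (le_trans (ler_piMl _ E1))// -{2}nk.
  rewrite (le_trans (HK _ _ _ kN0 r0))//.
  by rewrite ler_wpM2r ?invr_ge0 ?sqrtr_ge0// lerDl.
rewrite normrM nE; have /(ler_wpM2l (expR_ge0 (- (k / r)))) := HL k t r kN0 r1.
move=> /le_trans; apply; rewrite nk mulrDr mulrDl ler_wpDl//.
  by rewrite divr_ge0// sqr_ge0.
rewrite mulr2n mulrDl mul1r mulrDl lerD//.
  have /(ler_wpM2r (_ : 0 <= L / (r * k))) := E2.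
  move=> /(_ _)/le_trans; apply; first by rewrite divr_ge0// mulr_ge0// ltW.
  rewrite le_eqVlt; apply/orP; left; apply/eqP.
  by field; rewrite !gt_eqF.
by rewrite ler_piMl// divr_ge0// sqr_ge0.
Qed.

End improper_wave.

(** * Reflection and the dominating profile *)

Section reflection.
Variable R : realType.
Local Notation mu := (@lebesgue_measure R).
Implicit Types (g : R -> R).
Local Open Scope ereal_scope.

Lemma ge0_integral_Nyc_opp (u : R -> \bar R) : measurable_fun [set: R] u ->
  (forall x, 0 <= u x) ->
  \int[mu]_(x in `]-oo, 0%R]) u x = \int[mu]_(x in `]0%R, +oo[) u (- x)%R.
Proof.
move=> mu_ u0; have mN : measurable_fun [set: R] (fun x => u (- x)%R).
  apply: (measurableT_comp mu_); exact: oppr_measurable.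
rewrite integral_itv_obnd_cbnd; last exact: measurable_funTS.
rewrite ge0_integration_by_substitution0//.
by under [in RHS]eq_integral do rewrite opprK.
Qed.

Lemma integral_Nyc_opp (u : R -> \bar R) : measurable_fun [set: R] u ->
  \int[mu]_(x in `]-oo, 0%R]) u x = \int[mu]_(x in `]0%R, +oo[) u (- x)%R.
Proof.
move=> mu_; rewrite [LHS]integralE [RHS]integralE.
have -> := @ge0_integral_Nyc_opp u^\+ (measurable_funepos mu_)
  (@funepos_ge0 _ _ u).
have -> := @ge0_integral_Nyc_opp u^\- (measurable_funeneg mu_)
  (@funeneg_ge0 _ _ u).
by congr (_ - _); apply: eq_integral => x _; rewrite ?funeposE ?funenegE.
Qed.

(** Transfers estimates known for [k > 0] to the whole line. The point [0], where the transform has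
    no controlled value, falls into the reflected half as a null set. *)
Lemma integrable_symmetrize g : measurable_fun [set: R] g ->
  mu.-integrable `](0%R : R), +oo[ (EFin \o g) ->
  mu.-integrable `]0%R, +oo[ (fun x => (g (- x))%:E) ->
  mu.-integrable [set: R] (EFin \o g).
Proof.
move=> mg /integrableP[_ g1] /integrableP[_ g2].
have mEg : measurable_fun [set: R] (EFin \o g) by exact/measurable_EFinP.
have mag : measurable_fun [set: R]
  (fun x => `|(g x)%:E|) by exact: measurableT_comp.
apply/integrableP; split => //.
rewrite -(setUv [set` `]-oo, 0%R]]) setCitvl ge0_integral_setU//; last 2 first.
- by rewrite -setCitvl setUv.
- by rewrite disj_set2E -setCitvl setICr.
- rewrite ge0_integral_Nyc_opp//; exact: lte_add_pinfty.
Qed.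

Lemma Rintegral_symmetrize g : measurable_fun [set: R] g ->
  mu.-integrable `](0%R : R), +oo[ (EFin \o g) ->
  mu.-integrable `]0%R, +oo[ (fun x => (g (- x))%:E) ->
  (\int[mu]_x g x = \int[mu]_(x in `]0, +oo[) g x
    + \int[mu]_(x in `]0, +oo[) g (- x))%R.
Proof.
move=> mg g1 g2; have ig := integrable_symmetrize mg g1 g2.
have mEg : measurable_fun [set: R] (EFin \o g) by exact/measurable_EFinP.
rewrite -(setUv [set` `]-oo, 0%R]]) setCitvl Rintegral_setU//.
- by rewrite addrC; congr (_ + _)%R; rewrite /Rintegral integral_Nyc_opp.
- by rewrite -setCitvl setUv.
- by rewrite disj_set2E -setCitvl setICr.
Qed.

End reflection.

Section profile.
Variable R : realType.
Local Notation mu := (@lebesgue_measure R).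

Lemma profile_continuous_at (x : R) : 0 < x -> {for x, continuous (@profile R)}.
Proof.
move=> x0; rewrite /profile; apply: cvgV.
  by rewrite mulf_neq0// gt_eqF ?sqrtr_gt0// addr_gt0.
apply: cvgM; first exact: sqrt_continuous.
by apply: cvgD; [exact: cvg_cst|exact: cvg_id].
Qed.

Lemma is_derive_atan_sqrt (x : R) : 0 < x ->
  is_derive x 1 (fun y => 2 * atan (Num.sqrt y)) (profile x).
Proof.
move=> x0; have s0 : Num.sqrt x != 0 by rewrite gt_eqF// sqrtr_gt0.
have D := is_deriveZ 2
  (is_derive1_comp (is_derive1_atan (Num.sqrt x)) (is_derive1_sqrt x0)).
apply: is_derive_eq.
rewrite /GRing.scale/= sqr_sqrtr ?ltW// /profile; field.
by rewrite s0 gt_eqF// addr_gt0.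
Qed.

Lemma measurable_profile : measurable_fun `](0%R : R), +oo[ (@profile R).
Proof.
apply: open_continuous_measurable_fun => // x.
by rewrite inE/= in_itv/= andbT; exact: profile_continuous_at.
Qed.


(** The primitive [2 * atan (Num.sqrt x)] stays between [0] and [pi], whence a bound uniform in [a]
    and [b]. *)
Lemma integral_profile_le (a b : R) : 0 < a -> a <= b ->
  (\int[mu]_(x in `[a, b]) (profile x)%:E <= pi%:E)%E.
Proof.
move=> a0; rewrite le_eqVlt => /predU1P[<-|ab].
  by rewrite set_itv1 integral_set1 lee_fin pi_ge0.
have cF (x : R) : 0 < x -> {for x, continuous (fun y => 2 * atan (Num.sqrt y))}.
  move=> x0; apply: differentiable_continuous; apply/derivable1_diffP.
  by have [] := is_derive_atan_sqrt x0.
have pos (x : R) : x \in `]a, b[ -> 0 < x.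
  by rewrite in_itv/= => /andP[/(lt_trans a0)].
rewrite (continuous_FTC2 (F := fun y => 2 * atan (Num.sqrt y)) ab).
- rewrite -EFinB lee_fin -mulrBr.
  have := atan_ltpi2 (Num.sqrt b); have : 0 <= atan (Num.sqrt a).
    by rewrite -atan0 le_atan// sqrtr_ge0.
  lra.
- apply: continuous_in_subspaceT => x; rewrite inE/= in_itv/= => /andP[ax _].
  by apply: profile_continuous_at; exact: lt_le_trans ax.
- split.
  + by move=> x /pos x0; have [] := is_derive_atan_sqrt x0.
  + exact/cvg_at_right_filter/cF.
  + by apply/cvg_at_left_filter/cF; exact: lt_trans ab.
- by move=> x /pos x0; rewrite derive1E; have [_ ->] := is_derive_atan_sqrt x0.
Qed.

Lemma integrable_profile : mu.-integrable `](0%R : R), +oo[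
  (EFin \o @profile R).
Proof.
have mp : measurable_fun `](0%R : R), +oo[ (EFin \o @profile R).
  by apply/measurable_EFinP; exact: measurable_profile.
have p0 (x : R) : 0 < x -> 0 <= profile x by move=> x0; exact/profile_ge0/ltW.
apply/integrableP; split => //.
(* This exhaustion avoids the singularity at [0] and infinity at once; monotone convergence then
   passes the bound [pi] to the union. *)
pose F (n : nat) : set (measurableTypeR R) := [set` `[(n.+1%:R : R)^-1, n.+1%:R]].
have F0 n (x : R) : F n x -> 0 < x.
  by rewrite /F/= in_itv/= => /andP[+ _]; apply: lt_le_trans; rewrite invr_gt0.
have FE : \bigcup_n F n = [set` `]0, +oo[].
  apply/seteqP; split => [x [n _ /F0 x0]|x]; rewrite /= in_itv/= andbT// => x0.
  (* The two truncations make [n.+1] exceed both [x] and [x^-1]. *)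
  exists (Num.trunc x + Num.trunc x^-1)%N => //=; rewrite /F/= in_itv/=.
  apply/andP; split; last first.
    by apply/ltW/(lt_le_trans (truncnS_gt _)); rewrite ler_nat ltnS leq_addr.
  rewrite -[leRHS]invrK lef_pV2 ?posrE ?invr_gt0//.
  by apply/ltW/(lt_le_trans (truncnS_gt _)); rewrite ler_nat ltnS leq_addl.
have -> : (\int[mu]_(x in `]0%R, +oo[) `|(EFin \o @profile R) x|
    = \int[mu]_(x in \bigcup_n F n) (profile x)%:E)%E.
  rewrite FE; apply: eq_integral => x; rewrite inE/= in_itv/= andbT => x0.
  by rewrite ger0_norm// p0.
apply: (@le_lt_trans _ _ pi%:E); last exact: ltry.
have mF n : measurable (F n) by exact: measurable_itv.
have ndF : nondecreasing_seq F.
  move=> m n mn; apply/subsetPset => x; rewrite /F/= !in_itv/= => /andP[mx xm].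
  rewrite (le_trans _ mx) ?lef_pV2 ?posrE// ?ler_nat ?ltnS//=.
  by rewrite (le_trans xm)// ler_nat.
have := @ge0_nondecreasing_set_cvg_integral _ _ _ F
  (EFin \o @profile R) mu ndF mF.
move=> /(_ _ _)/cvge_to_le; apply.
- by move=> n; apply: measurable_funS mp => // x /F0; rewrite /= in_itv/= andbT.
- by move=> n x /F0 x0; rewrite lee_fin p0.
- apply: nearW => n; apply: integral_profile_le; first by rewrite invr_gt0.
  by rewrite (@le_trans _ _ 1)// ?invf_le1// ler1n.
Qed.
End profile.

(** * Exchange of integrals and the Poisson kernel *)

Section exchange.
Variable R : realType.
Local Notation mu := (@lebesgue_measure R).
Local Open Scope ereal_scope.

(** A bounded measurable function on a rectangle of finite measure is integrable, so Fubini
    applies. *)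
Lemma Rintegral_itv_exchange (u : R -> R -> R) (a b c d M : R) :
  measurable_fun [set: measurableTypeR R * measurableTypeR R]
    (fun p => u p.1 p.2) ->
  (forall x y, (a <= x <= b -> c <= y <= d -> `|u x y| <= M)%R) ->
  (\int[mu]_(x in `[a, b]) \int[mu]_(y in `[c, d]) u x y =
   \int[mu]_(y in `[c, d]) \int[mu]_(x in `[a, b]) u x y)%R.
Proof.
move=> mfu uM.
pose D : set (measurableTypeR R * measurableTypeR R) := `[a, b] `*` `[c, d].
have mD : measurable D by apply: measurableX.
(* Extension by zero puts the rectangle into Fubini over the plane; [E1] and [E2] then recover the
   iterated integrals over the segments. *)
pose F : _ -> \bar R := (fun p => (u p.1 p.2)%:E) \_ D.
have finI (x y : R) : mu `[x, y] < +oo.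
  by rewrite lebesgue_measure_itv/=; case: ifP => // _; rewrite -EFinB ltry.
have iF : (mu \x mu)%E.-integrable setT F.
  apply/integrable_restrict => //=; rewrite ?setTI.
  apply: (@measurable_bounded_integrable _ _ R (mu \x mu)
    (fun p => u p.1 p.2) D mD).
  - rewrite [X in X < _](_ : _ = mu `[a, b] * mu `[c, d]);
      last exact: product_measure1E.
    by apply: lte_mul_pinfty => //; rewrite ge0_fin_numE.
  - exact: measurable_funTS.
  - exists `|M|%R; split; first exact: num_real.
    move=> B MB p [/=]; rewrite !in_itv/= => /uM /[apply] /le_trans; apply.
    by rewrite (le_trans (ler_norm _))// ltW.
have ix x : (a <= x <= b)%R -> mu.-integrable `[c, d] (EFin \o u x).
  move=> xab; apply: (@measurable_bounded_integrable _ _ R mu (u x)) => //.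
  - exact: finI.
  - apply: measurable_funTS.
    exact: (measurableT_comp mfu (pair1_measurable _)).
  - exists `|M|%R; split; first exact: num_real.
    move=> B MB y/=; rewrite !in_itv/= => /(uM _ _ xab) /le_trans; apply.
    by rewrite (le_trans (ler_norm _))// ltW.
have iy y : (c <= y <= d)%R -> mu.-integrable `[a, b] (fun x => (u x y)%:E).
  move=> ycd; apply: (@measurable_bounded_integrable _ _ R mu (u ^~ y)) => //.
  - exact: finI.
  - apply: measurable_funTS.
    exact: (measurableT_comp mfu (pair2_measurable _)).
  - exists `|M|%R; split; first exact: num_real.
    move=> B MB x/=; rewrite !in_itv/= => /uM /(_ ycd) /le_trans; apply.
    by rewrite (le_trans (ler_norm _))// ltW.
have E1 : \int[mu]_x \int[mu]_y F (x, y) =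
    \int[mu]_(x in `[a, b]) (\int[mu]_(y in `[c, d]) u x y)%:E.
  rewrite [RHS]integral_mkcond; apply: eq_integral => x _; rewrite patchE.
  case: ifPn => [|xab].
    rewrite inE/= in_itv/= => xab; rewrite /Rintegral fineK; last first.
      exact/integrable_fin_num/ix.
    rewrite [RHS]integral_mkcond; apply: eq_integral => y _; rewrite /F !patchE.
    by congr (if _ then _ else _); apply/idP/idP; rewrite !inE/= !in_itv/=;
      [case|].
  rewrite -[RHS](@integral0 _ _ _ mu setT); apply: eq_integral => y _.
  rewrite /F patchE; case: ifPn => //; rewrite inE => -[/= xab' _].
  by move: xab; rewrite notin_setE.
have E2 : \int[mu]_y \int[mu]_x F (x, y) =
    \int[mu]_(y in `[c, d]) (\int[mu]_(x in `[a, b]) u x y)%:E.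
  rewrite [RHS]integral_mkcond; apply: eq_integral => y _; rewrite patchE.
  case: ifPn => [|ycd].
    rewrite inE/= in_itv/= => ycd; rewrite /Rintegral fineK; last first.
      exact/integrable_fin_num/iy.
    rewrite [RHS]integral_mkcond; apply: eq_integral => x _; rewrite /F !patchE.
    by congr (if _ then _ else _); apply/idP/idP; rewrite !inE/= !in_itv/=;
      [case|].
  rewrite -[RHS](@integral0 _ _ _ mu setT); apply: eq_integral => x _.
  rewrite /F patchE; case: ifPn => //; rewrite inE => -[/= _ ycd'].
  by move: ycd; rewrite notin_setE.
congr fine; rewrite -E1 -E2.
exact: (Fubini iF).
Qed.

End exchange.

Section poisson.
Variable R : realType.
Local Notation mu := (@lebesgue_measure R).
Implicit Types (e u N x y : R).

(** The real part of the integral of [e^(-(e - iu) k)]. As [N] grows, the term with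
    [expR (- (e * N))] dies out and leaves the Poisson kernel. *)
Lemma damped_cos_integral e u N : 0 < e -> 0 <= N ->
  \int[mu]_(k in `[0, N]) (expR (- (e * k)) * cos (k * u)) =
  (e + expR (- (e * N)) * (u * sin (N * u) - e * cos (N * u)))
    / (e ^+ 2 + u ^+ 2).
Proof.
move=> e0 N0; have d0 : e ^+ 2 + u ^+ 2 != 0.
  by rewrite gt_eqF// ltr_pwDl ?exprn_gt0// sqr_ge0.
pose F k := expR (- (e * k)) * (u * sin (k * u) - e * cos (k * u))
  / (e ^+ 2 + u ^+ 2).
have dF (k : R) : is_derive k 1 F (expR (- (e * k)) * cos (k * u)).
  apply: is_derive_eq; rewrite /GRing.scale /= !mulr1 ?addr0 ?add0r.
  by field.
have cF : continuous (fun k => expR (- (e * k)) * cos (k * u)).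
  apply: (@is_derive_continuous _ _ (fun k => - e * expR (- (e * k)) * cos
    (k * u)
    - u * expR (- (e * k)) * sin (k * u))) => k.
  apply: is_derive_eq; rewrite /GRing.scale /= !mulr1 ?addr0 ?add0r.
  by ring.
rewrite (Rintegral_itv_FTC N0 cF dF) /F !mulr0 !mul0r sin0 cos0 oppr0 expR0.
by rewrite -mulrBl; congr (_ / _); ring.
Qed.

End poisson.

Section poisson_kernel.
Variable R : realType.
Local Notation mu := (@lebesgue_measure R).
Implicit Types (f : R -> R) (a b e u N x y : R).

(** The Poisson kernel of the half-plane without its factor [pi^-1]: the total mass is [pi]. *)
Definition poisson e u : R := e / (e ^+ 2 + u ^+ 2).

Lemma poisson_denom_gt0 e u : 0 < e -> 0 < e ^+ 2 + u ^+ 2.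
Proof. by move=> e0; rewrite ltr_pwDl ?exprn_gt0// sqr_ge0. Qed.

Lemma poisson_ge0 e u : 0 < e -> 0 <= poisson e u.
Proof. by move=> e0; rewrite divr_ge0// ltW// poisson_denom_gt0. Qed.

Lemma continuous_poisson e x : 0 < e -> continuous (fun y => poisson e (y - x)).
Proof.
move=> e0 y; apply: cvgM; first exact: cvg_cst.
apply: cvgV; first by rewrite gt_eqF// poisson_denom_gt0.
apply: (@is_derive_continuous _ (fun y => e ^+ 2 + (y - x) ^+ 2)
  (fun y => 2 * (y - x))) => z.
by apply: is_derive_eq; rewrite /GRing.scale /=; ring.
Qed.

Lemma poisson_integral e x a b : 0 < e -> a <= b ->
  \int[mu]_(y in `[a, b]) poisson e (y - x)
    = atan ((b - x) / e) - atan ((a - x) / e).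
Proof.
move=> e0 ab.
have dF (y : R) :
    is_derive y 1 (fun z : R => atan ((z - x) / e)) (poisson e (y - x)).
  apply: is_derive_eq; rewrite /GRing.scale /= /poisson.
  have d0 := poisson_denom_gt0 (y - x) e0.
  field; rewrite gt_eqF// gt_eqF//.
by rewrite (Rintegral_itv_FTC ab (@continuous_poisson e x e0) dF).
Qed.

Lemma poisson_integral_le e x a b : 0 < e -> a <= b ->
  \int[mu]_(y in `[a, b]) poisson e (y - x) <= pi.
Proof.
move=> e0 ab; rewrite poisson_integral//.
have := atan_ltpi2 ((b - x) / e); have := atan_gtNpi2 ((a - x) / e); lra.
Qed.

(** Approximate-identity estimate: continuity at [x] within distance [d], the bound [2 * M] beyond.
    Comparing with [f x] times the mass over [[a, b]], rather than with [pi * f x], leaves the mass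
    lost outside [[a, b]] to a separate limit. *)
Lemma poisson_average_dist f x M d eta e a b : continuous f ->
  (forall y, `|f y| <= M) -> 0 < d ->
  (forall y, `|y - x| <= d -> `|f y - f x| <= eta) -> 0 < e -> a <= b ->
  `|\int[mu]_(y in `[a, b]) (f y * poisson e (y - x))
    - f x * \int[mu]_(y in `[a, b]) poisson e (y - x)|
  <= eta * pi + 2 * M * (1 + d ^- 2) * e * pi.
Proof.
move=> cf fM d0 fd e0 ab.
have M0 : 0 <= M by exact: le_trans (fM x).
have eta0 : 0 <= eta.
  by apply: le_trans (fd x _); rewrite ?subrr ?normr0// ltW.
have cP := @continuous_poisson e x e0.
have cP1 := @continuous_poisson 1 x ltr01.
have cfP : continuous (fun y => f y * poisson e
  (y - x)) by exact: continuous_funM.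
have cxP : continuous (fun y => f x * poisson e (y - x)).
  by apply: continuous_funM => //; exact: cst_continuous.
rewrite -RintegralZl//; last exact: continuous_integrable_itv.
rewrite -RintegralB//; try exact: continuous_integrable_itv.
pose c := 2 * M * (1 + d ^- 2) * e.
have c0 : 0 <= c.
  rewrite /c mulr_ge0 ?(ltW e0)// mulr_ge0 ?mulr_ge0// addr_ge0//.
  by rewrite invr_ge0 exprn_ge0// ltW.
have cE : continuous (fun y => eta * poisson e (y - x)).
  by apply: continuous_funM => //; exact: cst_continuous.
have cC : continuous (fun y => c * poisson 1 (y - x)).
  by apply: continuous_funM => //; exact: cst_continuous.
(* Away from [x] the kernel of width [e] is at most [(1 + d ^- 2) * e] times
   the kernel of width [1], which avoids splitting the integral. *)
apply: (@le_trans _ _ (\int[mu]_(y in `[a, b])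
    (eta * poisson e (y - x) + c * poisson 1 (y - x)))).
  apply: le_Rintegral_itv_norm.
  - by move=> y; apply: cvgB; [exact: cfP|exact: cxP].
  - by move=> y; apply: cvgD; [exact: cE|exact: cC].
  move=> y _; rewrite -mulrBl normrM (ger0_norm (poisson_ge0 _ e0)).
  have P0 := poisson_ge0 (y - x) e0; have P1 := poisson_ge0 (y - x) (@ltr01 R).
  have [yd|yd] := leP `|y - x| d.
    by apply: ler_wpDr; [exact: mulr_ge0|exact/ler_wpM2r/fd].
  apply: ler_wpDl; first exact: mulr_ge0.
  apply: (@le_trans _ _ (2 * M * poisson e (y - x))).
    apply: ler_wpM2r => //.
    by rewrite (le_trans (ler_normB _ _))// mulr2n mulrDl mul1r lerD.
  rewrite /c -!mulrA ler_wpM2l// ler_wpM2l//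
    /poisson mulrCA ler_wpM2l ?(ltW e0)//.
  set v := y - x.
  (* The claim amounts to [1 + v ^+ 2 <= (1 + d ^- 2) * (e ^+ 2 + v ^+ 2)], where the [1] is
     absorbed by [d ^- 2 * v ^+ 2]. *)
  have v2 : d ^+ 2 < v ^+ 2.
    by rewrite -[ltRHS]real_normK ?num_real// ltr_pXn2r ?nnegrE// ltW.
  have d2 : 0 < d ^+ 2 by rewrite exprn_gt0.
  have e2 : 0 < e ^+ 2 by rewrite exprn_gt0.
  rewrite expr1n mul1r ler_pdivlMr; last lra.
  rewrite mulrC ler_pdivrMr; last lra.
  rewrite mulrDl mul1r.
  have : v ^+ 2 <= e ^+ 2 + v ^+ 2 by lra.
  have : 1 <= d ^- 2 * (e ^+ 2 + v ^+ 2).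
    by rewrite mulrC ler_pdivlMr// mul1r; lra.
  lra.
rewrite RintegralD//; [|exact: continuous_integrable_itv..].
rewrite (RintegralZl eta)//; last exact: continuous_integrable_itv.
rewrite (RintegralZl c)//; last exact: continuous_integrable_itv.
by apply: lerD; apply: ler_wpM2l => //; exact: poisson_integral_le.
Qed.

End poisson_kernel.

(** * Damped means *)

Section summability.
Variable R : realType.
Local Notation mu := (@lebesgue_measure R).
Implicit Types (f : R -> R) (a b e k u r x y M N : R).

(** The phase [- (k * x)] turns the cosine into [cos (k * (y - x))], so the inner integral, once
    taken in [k], is [damped_cos_integral] at [u = y - x]. *)
Lemma damped_wave_exchange f M x e N r : continuous f ->
  (forall y, `|f y| <= M) ->
  0 < e -> 0 <= N -> 0 <= r ->
  \int[mu]_(k in `[0, N]) (expR (- (e * k)) * wave f k (- (k * x)) (- r) r) =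
  \int[mu]_(y in `[- r, r]) (f y * ((e + expR (- (e * N)) *
      ((y - x) * sin (N * (y - x)) - e * cos (N * (y - x))))
    / (e ^+ 2 + (y - x) ^+ 2))).
Proof.
move=> cf fM e0 N0 r0.
pose u k y := expR (- (e * k)) * (f y * cos (k * y + - (k * x))).
have mp1 : measurable_fun [set: measurableTypeR R * measurableTypeR R]
  (fst : _ -> measurableTypeR R) := measurable_fst.
have mp2 : measurable_fun [set: measurableTypeR R * measurableTypeR R]
  (snd : _ -> measurableTypeR R) := measurable_snd.
have mu_ : measurable_fun [set: measurableTypeR R * measurableTypeR R]
    (fun p => u p.1 p.2).
  apply: measurable_funM.
    apply: (measurableT_comp (f := fun k => expR (- (e * k)))) mp1.
    apply: continuous_measurable_fun.
    apply: (@is_derive_continuous _ _ (fun k => - e * expR (- (e * k)))) => k.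
    by apply: is_derive_eq; rewrite /GRing.scale /=; ring.
  apply: measurable_funM.
    by apply: (measurableT_comp (f := f)) mp2; exact: continuous_measurable_fun.
  apply: (measurableT_comp (f := cos)).
    by apply: continuous_measurable_fun; exact: continuous_cos.
  apply: measurable_funD; first exact: measurable_funM.
  by apply: measurable_funN; apply: measurable_funM => //;
    exact: measurable_cst.
have uM k y : 0 <= k <= N -> - r <= y <= r -> `|u k y| <= M.
  move=> /andP[k0 _] _; rewrite normrM ger0_norm ?expR_ge0// -[leRHS]mul1r.
  rewrite ler_pM ?expR_ge0//.
    by rewrite -expR0 ler_expR oppr_le0 mulr_ge0// ltW.
  exact: le_trans (norm_mul_cos_le _ _) (fM y).
transitivity (\int[mu]_(k in `[0, N]) \int[mu]_(y in `[- r, r]) u k y).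
  apply: eq_Rintegral => k _; rewrite RintegralZl//.
  by apply: continuous_integrable_itv; exact: continuous_mul_wave.
rewrite (Rintegral_itv_exchange mu_ uM); apply: eq_Rintegral => y _.
rewrite -damped_cos_integral// -RintegralZl//.
  by apply: eq_Rintegral => k _; rewrite /u mulrCA mulrBr.
apply: continuous_integrable_itv.
apply: (@is_derive_continuous _ _ (fun k => - e * expR (- (e * k)) * cos (k *
  (y - x))
    - (y - x) * expR (- (e * k)) * sin (k * (y - x)))) => k.
apply: is_derive_eq; rewrite /GRing.scale /= !mulr1 ?addr0 ?add0r.
by ring.
Qed.

(* Cutting [k] at [r ^+ 4] keeps the exchange of integrals on a compact
   rectangle, at the cost of an error of order [expR (- r ^+ 3)]. *)
Definition damped_mean f x r : R := \int[mu]_(k in `[0, r ^+ 4])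
  (expR (- (k / r)) * wave f k (- (k * x)) (- r) r).

(** The kernels differ by a term with factor [expR (- r ^+ 3)]. Its cofactor is at most [2 * r] and
    the window has length [2 * r], so the error is at most [4 * M * r ^+ 2 * expR (- r ^+ 3)]; the
    crude bound [(1 + r ^+ 3)^-1] for the exponential already gives [4 * M / r]. *)
Lemma damped_mean_dist f M x r : continuous f -> (forall y, `|f y| <= M) ->
  1 <= r ->
  `|damped_mean f x r
    - \int[mu]_(y in `[- r, r]) (f y * poisson r^-1 (y - x))| <= 4 * M / r.
Proof.
move=> cf fM r1; have r0 : 0 < r by rewrite (lt_le_trans _ r1).
have M0 : 0 <= M by exact: le_trans (fM 0).
rewrite /damped_mean.
under eq_Rintegral do rewrite [_ / r]mulrC.
rewrite (damped_wave_exchange _ cf fM) ?invr_gt0 ?exprn_ge0 ?(ltW r0)//.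
have e0 : 0 < r^-1 by rewrite invr_gt0.
set e := r^-1; set E := expR (- (e * r ^+ 4)).
have EE : E <= (1 + r ^+ 3)^-1.
  rewrite /E expRN lef_pV2 ?posrE ?expR_gt0//;
    last by rewrite addr_gt0// exprn_gt0.
  rewrite (le_trans _ (expR_ge1Dx _))// lerD2l /e exprS mulKf//.
  by rewrite gt_eqF.
have E0 : 0 <= E by exact: expR_ge0.
pose w y := (y - x) * sin (r ^+ 4 * (y - x)) - e * cos (r ^+ 4 * (y - x)).
pose d y := e ^+ 2 + (y - x) ^+ 2.
have d0 y : 0 < d y by exact: poisson_denom_gt0.
have cd : continuous (fun y => (d y)^-1).
  move=> y; apply: cvgV; first by rewrite gt_eqF.
  apply: (@is_derive_continuous _ d (fun y => 2 * (y - x))) => z.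
  by apply: is_derive_eq; rewrite /GRing.scale /=; ring.
have cw : continuous w.
  apply: (@is_derive_continuous _ _ (fun y => sin (r ^+ 4 * (y - x))
    + (y - x) * (r ^+ 4 * cos (r ^+ 4 * (y - x)))
    + e * (r ^+ 4 * sin (r ^+ 4 * (y - x))))) => y.
  by apply: is_derive_eq; rewrite /GRing.scale /=; ring.
have cq : continuous (fun y => f y * ((e + E * w y) / d y)).
  apply: continuous_funM => //; apply: continuous_funM => // y.
  apply: cvgD; first exact: cvg_cst.
  by apply: cvgM; [exact: cvg_cst|exact: cw].
have cp : continuous (fun y => f y * poisson e (y - x)).
  by apply: continuous_funM => //; exact: continuous_poisson.
rewrite -[X in `|X - _|]/(\int[mu]_(y in `[- r, r]) (f y *
  ((e + E * w y) / d y))).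
rewrite -RintegralB//; [|exact: continuous_integrable_itv..].
have qp y : f y * ((e + E * w y) / d y) - f y * poisson e (y - x)
    = f y * (E * (w y / d y)).
  by rewrite /poisson -/(d y); field; rewrite gt_eqF.
have wd y : `|w y / d y| <= 2 / e.
  rewrite normrM normfV (gtr0_norm (d0 y)) ler_pdivrMr// mulrAC.
  rewrite ler_pdivlMr//.
  have w1 : `|w y| <= `|y - x| + e.
    rewrite (le_trans (ler_normB _ _))// lerD ?norm_mul_sin_le//.
    by rewrite (le_trans (norm_mul_cos_le _ _))// ger0_norm// ltW.
  rewrite (le_trans (ler_wpM2r (ltW e0) w1))//
    /d -[(y - x) ^+ 2]real_normK ?num_real//.
  set a := `|y - x|.
  (* A sum of squares witnessing [(a + e) * e <= 2 * (e ^+ 2 + a ^+ 2)]. *)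
  rewrite -subr_ge0 (_ : _ - _ = ((a - e) ^+ 2 + e ^+ 2 + 3 * a ^+ 2) / 2).
    by rewrite divr_ge0// !addr_ge0 ?sqr_ge0// mulr_ge0// sqr_ge0.
  by rewrite -/e; field.
apply: (@le_trans _ _ (M * (E * (2 / e)) * (r - - r))).
  apply: Rintegral_itv_bound; first by rewrite ge0_cp// ltW.
    by move=> y; apply: cvgB; [exact: cq|exact: cp].
  move=> y _; rewrite qp normrM ler_pM// normrM ger0_norm// ler_wpM2l//.
rewrite opprK /e invrK.
have -> : M * (E * (2 * r)) * (r + r) = 4 * M / r * (r ^+ 3 * E).
  by field; rewrite gt_eqF.
rewrite ler_piMr ?divr_ge0 ?mulr_ge0 ?(ltW r0)//.
rewrite (le_trans (ler_wpM2l _ EE)) ?exprn_ge0 ?(ltW r0)//.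
have r3 : 0 < r ^+ 3 by rewrite exprn_gt0.
by rewrite ler_pdivrMr ?mul1r; lra.
Qed.

(** Dominated convergence runs along sequences, so [r] is taken to be [n.+1], which always satisfies
    [1 <= r]. *)
Lemma cvg_natS_pinfty : (n.+1%:R : R) @[n --> \oo] --> +oo.
Proof.
apply/cvgryPge => A; near=> n.
have : A <= n%:R by near: n; apply: nbhs_infty_ger.
by move=> /le_trans; apply; rewrite ler_nat.
Unshelve. all: by end_near. Qed.

(** In units of the width [1 / r], the ends of the window sit at [(r - x) * r] and [(- r - x) * r],
    which go to [+oo] and [-oo]; each side contributes [pi / 2]. *)
Lemma cvg_poisson_mass x :
  \int[mu]_(y in `[- n.+1%:R, n.+1%:R]) poisson n.+1%:R^-1 (y - x)
    @[n --> \oo] --> pi.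
Proof.
have cvg_at y : (fun n => atan ((n.+1%:R - y) * n.+1%:R)) @ \oo -->
  (pi / 2 : R).
  apply: (cvg_comp (fun n => (n.+1%:R - y) * n.+1%:R : R)) (@cvgy_atan R).
  apply/cvgryPge => A; near=> n.
  have A1 : `|A| <= n%:R by near: n; apply: nbhs_infty_ger.
  have y1 : `|y| <= n%:R by near: n; apply: nbhs_infty_ger.
  rewrite (le_trans (ler_norm _))// (le_trans A1)//.
  have n0 : 0 <= n%:R :> R by [].
  have := ler_norm y; rewrite -natr1; nra.
have -> : (fun n => \int[mu]_(y in `[- n.+1%:R, n.+1%:R])
      poisson n.+1%:R^-1 (y - x)) =
    (fun n => atan ((n.+1%:R - x) * n.+1%:R) + atan
      ((n.+1%:R - - x) * n.+1%:R)).
  apply/funext => n; rewrite poisson_integral ?invr_gt0// ?invrK; last first.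
    by rewrite ge0_cp.
  by rewrite -atanN -mulNr opprB !opprK [x + _]addrC.
rewrite (_ : pi = pi / 2 + pi / 2 :> R); last by field.
exact: cvgD.
Unshelve. all: by end_near. Qed.

Lemma cvg_damped_mean f M x : continuous f -> (forall y, `|f y| <= M) ->
  damped_mean f x n.+1%:R @[n --> \oo] --> pi * f x.
Proof.
move=> cf fM; have M0 : 0 <= M by exact: le_trans (fM x).
pose A n := \int[mu]_(y in `[- n.+1%:R, n.+1%:R]) poisson (n.+1%:R : R)^-1
  (y - x).
suff D : (fun n => damped_mean f x n.+1%:R - f x * A n) @ \oo --> (0 : R).
  have -> : (fun n => damped_mean f x n.+1%:R) =
      (fun n => (damped_mean f x n.+1%:R - f x * A n) + f x * A n).
    by apply/funext => n; rewrite subrK.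
  rewrite -[pi * f x]add0r mulrC; apply: cvgD => //.
  by apply: cvgM; [exact: cvg_cst|exact: cvg_poisson_mass].
apply/cvgr0Pnorm_le => eps eps0.
have pi0 : 0 < pi :> R := pi_gt0 R.
have eta0 : 0 < eps / (2 * pi) by rewrite divr_gt0// mulr_gt0.
have /cvgrPdistC_le/(_ _ eta0) := cf x.
move=> /nbhs_ballP[d /= d0 fd].
(* The ball of radius [d] is open while [poisson_average_dist] uses a closed condition, hence the
   halving. *)
have d20 : 0 < d / 2 by rewrite divr_gt0.
have fd2 y : `|y - x| <= d / 2 -> `|f y - f x| <= eps / (2 * pi).
  move=> yd; apply: fd; rewrite /ball/= distrC (le_lt_trans yd)//.
  by rewrite ltr_pdivrMr// ltr_pMr// ltr1n.
(* [B / r] gathers the errors of order [1 / r]; the continuity error is [eps / (2 * pi) * pi], the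
   other half of [eps]. *)
pose B := 4 * M + 2 * M * (1 + (d / 2) ^- 2) * pi.
near=> n.
have r1 : 1 <= n.+1%:R :> R by rewrite ler1n.
have r0 : 0 < n.+1%:R :> R by [].
have rB : B / (eps / 2) <= n.+1%:R.
  apply: (@le_trans _ _ n%:R); last by rewrite ler_nat.
  by near: n; apply: nbhs_infty_ger.
rewrite ler_pdivrMr ?divr_gt0// in rB.
have D1 := damped_mean_dist x cf fM r1.
have rr : - n.+1%:R <= n.+1%:R :> R by rewrite ge0_cp.
have ri : 0 < n.+1%:R^-1 :> R by rewrite invr_gt0.
have D2 := poisson_average_dist cf fM d20 fd2 ri rr.
rewrite (le_trans (ler_distD (\int[mu]_(y in `[- n.+1%:R, n.+1%:R])
  (f y * poisson n.+1%:R^-1 (y - x))) _ _))// (le_trans (lerD D1 D2))//.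
have F (p r c : R) : p != 0 -> r != 0 -> 4 * M / r + (eps / (2 * p) * p
    + 2 * M * c / r * p) = eps / 2 + (4 * M + 2 * M * c * p) / r.
  by move=> pn0 rn0; field; rewrite pn0 rn0.
rewrite F ?gt_eqF// -/B.
by rewrite [leRHS](splitr eps) lerD2l ler_pdivrMr// mulrC.
Unshelve. all: by end_near. Qed.

End summability.

(** * Inversion for the real oscillating integrals *)

Section inversion.
Variable R : realType.
Local Notation mu := (@lebesgue_measure R).
Implicit Types (f g h : R -> R) (a b c e k r t x y M : R).

(** The affine phase covers the constant phases of the transform ([c = 0]) as well as the phase
    [- (k * x)] of its inversion. Continuity in [k] serves measurability. *)
Lemma continuous_wave_freq f c t r : continuous f ->
  continuous (fun k => wave f k (c * k + t) (- r) r).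
Proof.
move=> cf k; have kI : k \in [set` `]k - 1, k + 1[].
  by rewrite inE/= in_itv/= ltrBlDr ltrDl ltr01.
apply: (@continuity_under_integral _ _ _ mu
  (fun k y => f y * cos (k * y + (c * k + t))) `[- r, r] _ (k - 1) (k + 1)
  _ _ (fun y => `|f y|)) => //.
- by move=> l _; apply: continuous_integrable_itv; exact: continuous_mul_wave.
- apply: aeW => y _ l _; apply: cvgM; first exact: cvg_cst.
  apply: (@is_derive_continuous _ (fun l => cos (l * y + (c * l + t)))
    (fun l => - (y + c) * sin (l * y + (c * l + t)))).
  by move=> z; apply: is_derive_eq; rewrite /GRing.scale /=; ring.
- by apply: continuous_integrable_itv; exact: continuous_norm.
- by move=> l _; apply: aeW => y _; exact: norm_mul_cos_le.
Qed.

Lemma cvg_wave_nat f g k t : bitame f g -> k != 0 ->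
  wave f k t (- n.+1%:R) n.+1%:R @[n --> \oo] --> improper_wave f k t.
Proof.
move=> tf k0.
have H := @cvg_comp _ _ _ (fun n : nat => n.+1%:R : R)
  (fun r => wave f k t (- r) r) _ _ _ (@cvg_natS_pinfty R) (wave_cvg
    (t := t) tf k0).
exact: H.
Qed.

(** A pointwise limit of continuous functions of [k], restricted to the frequencies where
    convergence is known. *)
Lemma measurable_improper_wave f g c t : bitame f g ->
  measurable_fun (~` [set (0 : R)]) (fun k => improper_wave f k (c * k + t)).
Proof.
move=> tf; have cf := tame_continuous (proj1 tf).
apply: (@measurable_fun_cvg _ _ _ _
  (fun n k => wave f k (c * k + t) (- n.+1%:R) n.+1%:R)).
- move=> n; apply: measurable_funTS; apply: continuous_measurable_fun.
  exact: continuous_wave_freq.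
- by move=> k /eqP k0; exact: cvg_wave_nat tf k0.
Qed.

Lemma measurable_improper_wave_gt0 f g c t : bitame f g ->
  measurable_fun `](0 : R), +oo[ (fun k => improper_wave f k (c * k + t)).
Proof.
move=> tf; apply: (measurable_funS _ _ (measurable_improper_wave c t tf)) => //.
  exact: measurableC.
by move=> k /=; rewrite in_itv/= andbT => k0; apply/eqP; rewrite gt_eqF.
Qed.

Lemma integrable_scaled_profile c :
  mu.-integrable `](0 : R), +oo[ (fun k => (c * profile k)%:E).
Proof. exact: (integrableZl _ c (@integrable_profile R)). Qed.

Lemma integrable_improper_wave f g h c t : bitame f g -> bitame g h ->
  mu.-integrable `](0 : R), +oo[
    (fun k => (improper_wave f k (c * k + t))%:E).
Proof.
move=> tf tg; have [K K0 HK] := improper_wave_le_profile tf tg.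
apply: (@le_integrable _ _ _ mu _ _ _ (fun k => (K * profile k)%:E)) => //.
- by apply/measurable_EFinP; exact: measurable_improper_wave_gt0 tf.
- move=> k /=; rewrite in_itv/= andbT => k0; rewrite lee_fin.
  have kn0 : k != 0 by rewrite gt_eqF.
  by rewrite (le_trans (HK _ _ kn0))// gtr0_norm// ler_norm.
- exact: integrable_scaled_profile.
Qed.

(** Inversion on the half-line: the same sequence of integrals tends to the left side by dominated
    convergence and to the right side by [cvg_damped_mean]. *)
Lemma Rintegral_improper_wave f g h x : bitame f g -> bitame g h ->
  \int[mu]_(k in `]0, +oo[) improper_wave f k (- (k * x)) = pi * f x.
Proof.
move=> tf tg; have [K K0 HK] := damped_wave_le_profile tf tg.
have cf := tame_continuous (proj1 tf).
have [_ _ _ [C fC] _] := proj1 tf.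
have fM y : `|f y| <= C.
  by rewrite (le_trans _ (fC y))// ler_peMl// lerDl.
have phase k : - (k * x) = - x * k + 0 by rewrite addr0 mulNr mulrC.
pose D : set (measurableTypeR R) := `](0 : R), +oo[%classic.
pose v n k : R := expR (- (k / n.+1%:R))
  * wave f k (- (k * x)) (- n.+1%:R) n.+1%:R.
(* The range of [k] in [damped_mean]; every fixed [k > 0] eventually lies in it, so the cut does not
   alter the pointwise limit. *)
pose I n : set (measurableTypeR R) := `[(0 : R), n.+1%:R ^+ 4]%classic.
have cv n : continuous (v n).
  apply: continuous_funM.
    apply: (@is_derive_continuous _ _
      (fun k => - n.+1%:R^-1 * expR (- (k / n.+1%:R)))) => z.
    by apply: is_derive_eq; rewrite /GRing.scale /=; ring.
  have -> : (fun k => wave f k (- (k * x)) (- n.+1%:R) n.+1%:R) =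
      (fun k => wave f k (- x * k + 0) (- n.+1%:R) n.+1%:R).
    by apply/funext => k; rewrite phase.
  exact: continuous_wave_freq.
have mD : measurable D by exact: measurable_itv.
have mI n : measurable (I n) by exact: measurable_itv.
have mv n : measurable_fun D (EFin \o (v n \_ (I n))).
  apply/measurable_EFinP/measurable_funTS.
  apply/(measurable_restrictT _ (mI n)).
  by apply: measurable_funTS; exact: continuous_measurable_fun.
have mw : measurable_fun D (fun k => (improper_wave f k (- (k * x)))%:E).
  apply/measurable_EFinP.
  under eq_fun do rewrite phase.
  exact: measurable_improper_wave_gt0 tf.
have vw : {ae mu, forall k, D k ->
    (fun n => (EFin \o (v n \_ (I n))) k) @ \oo -->
      (improper_wave f k (- (k * x)))%:E}.
  apply: aeW => k; rewrite /D/= in_itv/= andbT => k0.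
  apply: cvg_EFin; first exact: nearW.
  have E : \forall n \near \oo, v n k = (v n \_ (I n)) k.
    near=> n; rewrite patchE mem_set// /I/= in_itv/= (ltW k0)/=.
    have kn : k <= n%:R by near: n; apply: nbhs_infty_ger.
    have n1 : 1 <= n.+1%:R :> R by rewrite ler1n.
    rewrite (le_trans kn)// (@le_trans _ _ n.+1%:R) ?ler_nat//.
    by rewrite ler_eXnr.
  apply: (cvg_trans (near_eq_cvg E)).
  have e1 : expR (- (k / n.+1%:R)) @[n --> \oo] --> (1 : R).
    have : expR (- (k / n.+1%:R)) @[n --> \oo] --> expR (- (k * 0)).
      apply: continuous_cvg; first exact: continuous_expR.
      by apply: cvgN; apply: cvgM; [exact: cvg_cst|exact: cvg_harmonic].
    by rewrite mulr0 oppr0 expR0.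
  have kn0 : k != 0 by rewrite gt_eqF.
  have := cvgM e1 (cvg_wave_nat (t := - (k * x)) tf kn0).
  by rewrite mul1r; exact.
have vK : {ae mu, forall k n, D k ->
    (`|(EFin \o (v n \_ (I n))) k| <= (K * profile k)%:E)%E}.
  apply: aeW => k n; rewrite /D/= in_itv/= andbT => k0.
  rewrite lee_fin patchE; case: ifPn => _.
    by apply: HK => //; rewrite ler1n.
  by rewrite normr0 mulr_ge0// profile_ge0// ltW.
have [iw _ cvgI] := dominated_convergence mD mv mw vw
  (@integrable_scaled_profile K) vK.
have vE n : (\int[mu]_(k in D) (EFin \o (v n \_ (I n))) k
    = (damped_mean f x n.+1%:R)%:E)%E.
  rewrite -restrict_EFin -integral_mkcondr.
  have -> : D `&` I n = `](0 : R), n.+1%:R ^+ 4]%classic.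
    apply/seteqP; split => k; rewrite /D /I/= !in_itv/= ?andbT.
      by move=> [-> /andP[_ ->]].
    by move=> /andP[k0 kn]; rewrite k0 (ltW k0).
  rewrite integral_itv_obnd_cbnd; last first.
    by apply/measurable_EFinP/measurable_funTS;
      exact: continuous_measurable_fun.
  rewrite /damped_mean /Rintegral fineK//.
  by apply: integrable_fin_num => //; exact: continuous_integrable_itv (cv n).
have L := @cvg_damped_mean _ _ _ x cf fM.
apply: EFin_inj; rewrite /Rintegral fineK; last exact: integrable_fin_num.
have L' : (fun n => (damped_mean f x n.+1%:R)%:E) @ \oo --> (pi * f x)%:E.
  by apply: cvg_EFin => //; exact: nearW.
rewrite -(cvg_lim _ L')// -(cvg_lim _ cvgI)//.
by congr (lim (_ @ \oo)); apply/funext => n; exact: vE.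
Unshelve. all: by end_near. Qed.

End inversion.

(** * From real to complex integrals *)

Section hypotheses.
Variable R : realType.
Implicit Types (f g h : R -> R).

Lemma bounded_fun_le f : bounded_fun f -> exists M : R, forall x, `|f x| <= M.
Proof.
move=> [M [_ fM]]; exists (`|M| + 1) => x; apply: fM => //.
by rewrite (le_lt_trans (ler_norm _))// ltrDl.
Qed.

Lemma decrease_le f : very_moderate_decrease f -> bounded_fun f ->
  exists C : R, forall x, (1 + `|x|) * `|f x| <= C.
Proof.
move=> [_ [C C0 fC]] /bounded_fun_le[M fM].
have M0 : 0 <= M by exact: le_trans (fM 0).
(* [2 * M] covers [|x| <= 1]; beyond, [1 + |x| <= 2 * |x|] gives [2 * C]. *)
exists (2 * C + 2 * M) => x; have [x1|x1] := leP `|x| 1.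
  rewrite ler_wpDl ?mulr_ge0 ?(ltW C0)// ler_pM ?addr_ge0//.
  by rewrite mulr2n lerD2l.
have x0 : 0 < `|x| by rewrite (lt_trans _ x1).
rewrite ler_wpDr ?mulr_ge0//.
apply: (@le_trans _ _ ((2 * `|x|) * (C / `|x|))).
  rewrite ler_pM ?addr_ge0 ?fC// mulr2n mulrDl mul1r lerD2r.
  exact: ltW.
by rewrite le_eqVlt; apply/orP; left; apply/eqP; field; rewrite gt_eqF.
Qed.

(** The last breakpoint serves as [Y] for [f], and minus the first one for the reflected function,
    whose sense of monotonicity is reversed. *)
Lemma bitame_intro f g : (forall x : R, is_derive x 1 f
  (g x)) -> continuous g ->
  bounded_fun f -> bounded_fun g -> very_moderate_decrease f ->
  non_oscillatory f -> bitame f g.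
Proof.
move=> df cg bf bg vf [_ [ys [_ _ mNy my]]].
have [M gM] := bounded_fun_le bg; have [C fC] := decrease_le vf bf.
split; split.
- exact: df.
- exact: cg.
- by exists M.
- by exists C.
- by exists ys`_(size ys).-1.
- move=> x; have dfx := df (- x).
  have -> : - g (- x) = g (- x) * -1 by rewrite mulrN1.
  exact: (is_derive1_comp dfx).
- move=> x; apply: cvgN; apply: (@continuous_comp _ _ _ -%R g); last exact: cg.
  exact: opp_continuous.
- by exists M => x; rewrite normrN.
- by exists C => x; rewrite -normrN.
- exists (- ys`_0).
  have oN x : x \in `](- ys`_0), +oo[ -> - x \in `]-oo, ys`_0[.
    by rewrite !in_itv/= andbT ltrNl.
  case: mNy => mf; [right|left] => x y /oN xN /oN yN xy.
    by apply: mf => //; rewrite lerN2.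
  by apply: mf => //; rewrite lerN2.
Qed.

End hypotheses.

Section complex_limits.
Variable R : realType.

Lemma sqrt_sqrD_le (p q : R) : Num.sqrt (p ^+ 2 + q ^+ 2) <= `|p| + `|q|.
Proof.
rewrite -[leRHS]ger0_norm ?addr_ge0// -sqrtr_sqr ler_sqrt ?sqr_ge0//.
rewrite sqrrD !real_normK ?num_real// -addrA lerD2l lerDr.
by rewrite mulrn_wge0// mulr_ge0.
Qed.

Lemma cvg_complex (T : Type) (F : set_system T) (FF : Filter F) (u v : T -> R)
    (a b : R) :
  u @ F --> a -> v @ F --> b ->
  (fun t => (u t +i* v t : R[i]^o)) @ F --> (a +i* b : R[i]^o).
Proof.
move=> ua vb; apply/cvgrPdist_lt => e e0.
(* In the order of [R[i]], a positive radius is a real number. *)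
have [er ei] : 0 < complex.Re e /\ complex.Im e = 0.
  by move: e0; rewrite ltcE/= => /andP[/eqP -> ->].
have e2 : 0 < complex.Re e / 2 by rewrite divr_gt0.
have /cvgrPdist_lt/(_ _ e2) ua' := ua; have /cvgrPdist_lt/(_ _ e2) vb' := vb.
near=> t.
have ut : `|a - u t| < complex.Re e / 2 by near: t.
have vt : `|b - v t| < complex.Re e / 2 by near: t.
rewrite ltcE/= ei eqxx/=.
rewrite (le_lt_trans (sqrt_sqrD_le _ _))// [ltRHS]splitr.
exact: ltrD.
Unshelve. all: by end_near. Qed.

End complex_limits.

Section fourier_as_wave.
Variable R : realType.
Local Notation mu := (@lebesgue_measure R).
Implicit Types (f g h : R -> R) (k r s t x : R).

Lemma cexp_imaginary t : cexp (0 +i* t) = cos t +i* sin t :> R[i].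
Proof. by rewrite /cexp/= expR0; simpc. Qed.

Lemma truncated_fourierE f k r :
  truncated_fourier f k r = wave f k 0 (- r) r +i* wave f k (pi / 2) (- r) r.
Proof.
rewrite /truncated_fourier /cintegral.
have E y : (f y)%:C * cexp (- ('i%C * k%:C * y%:C)) =
    (f y * cos (k * y + 0)) +i* (f y * cos (k * y + pi / 2)).
  have -> : - ('i%C * k%:C * y%:C) = 0 +i* (- (k * y)) :> R[i] by simpc.
  rewrite cexp_imaginary cosN sinN addr0 cosDpihalf.
  by simpc.
by congr (_ +i* _); apply: eq_Rintegral => y _; rewrite E.
Qed.

Lemma truncated_fourier_cvg f g k : bitame f g -> k != 0 ->
  truncated_fourier f k r @[r --> +oo] -->
    (improper_wave f k 0 +i* improper_wave f k (pi / 2) : R[i]^o).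
Proof.
move=> tf k0; under eq_fun do rewrite truncated_fourierE.
by apply: cvg_complex; exact: wave_cvg tf k0.
Qed.

Lemma fourierE f g k : bitame f g -> k != 0 ->
  fourier f k = (Num.sqrt (2 * pi))^-1 * improper_wave f k 0
    +i* ((Num.sqrt (2 * pi))^-1 * improper_wave f k (pi / 2)).
Proof.
move=> tf k0; rewrite /fourier (cvg_lim _ (truncated_fourier_cvg tf k0)).
  by simpc.
exact: norm_hausdorff.
Qed.

(** The addition formula of the cosine, carried through the limit: phases [t] and [t + pi / 2]
    determine all others. *)
Lemma improper_waveD f g k t s : bitame f g -> k != 0 ->
  improper_wave f k (t + s) =
    cos s * improper_wave f k t + sin s * improper_wave f k (t + pi / 2).
Proof.
move=> tf k0; have cf := tame_continuous (proj1 tf).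
apply/cvg_lim => //.
have -> : (fun r => wave f k (t + s) (- r) r) =
    (fun r => cos s * wave f k t (- r) r + sin s * wave f k (t + pi / 2)
      (- r) r).
  apply/funext => r; rewrite -!RintegralZl//;
    try (by apply: continuous_integrable_itv; exact: continuous_mul_wave).
  rewrite -RintegralD//; first last.
  - apply: continuous_integrable_itv; apply: continuous_funM.
      exact: cst_continuous.
    exact: continuous_mul_wave.
  - apply: continuous_integrable_itv; apply: continuous_funM.
      exact: cst_continuous.
    exact: continuous_mul_wave.
  apply: eq_Rintegral => y _.
  by rewrite !addrA cosDpihalf cosD; ring.
by apply: cvgD; apply: cvgM; do ?[exact: cvg_cst|exact: wave_cvg tf k0].
Qed.

Lemma improper_wave_neg f k t : improper_wave f (- k) t = improper_wave f k
  (- t).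
Proof.
rewrite /improper_wave; congr (lim (_ @ +oo)); apply/funext => r.
apply: eq_Rintegral => y _; rewrite -[in RHS]cosN.
by congr (_ * cos _); ring.
Qed.

(** Since [e^(-iky) e^(ikx) = e^(-ik(y - x))], the factor acts as a phase shift by [- (k * x)] on
    both components. *)
Lemma fourier_cexpE f g k x : bitame f g -> k != 0 ->
  fourier f k * cexp ('i%C * k%:C * x%:C) =
    ((Num.sqrt (2 * pi))^-1 * improper_wave f k (- (k * x)))
    +i* ((Num.sqrt (2 * pi))^-1 * improper_wave f k (pi / 2 - k * x)).
Proof.
move=> tf k0; rewrite (fourierE tf k0).
have -> : 'i%C * k%:C * x%:C = 0 +i* (k * x) :> R[i] by simpc.
rewrite cexp_imaginary -[- (k * x)]add0r (improper_waveD 0 (- (k * x)) tf k0).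
rewrite add0r (improper_waveD (pi / 2) (- (k * x)) tf k0).
rewrite cosN sinN.
(* Shifting the imaginary part produces the phase [pi], which is the phase [0] with the opposite
   sign. *)
have -> : pi / 2 + pi / 2 = 0 + pi :> R by field.
rewrite (improper_waveD 0 pi tf k0) cospi sinpi add0r.
by simpc; congr (_ +i* _); ring.
Qed.

End fourier_as_wave.

(** * Fourier inversion *)

Section fourier_inversion.
Variable R : realType.
Local Notation mu := (@lebesgue_measure R).
Implicit Types (f g h u v : R -> R) (k t x : R).

(** The value at [0] may be the default of [lim], but any function is measurable on a singleton. *)
Lemma measurable_fun_off0 u : measurable_fun (~` [set (0 : R)]) u ->
  measurable_fun [set: R] u.
Proof.
move=> mu_; rewrite -(setvU [set (0 : R)]); apply/measurable_funU => //.
  exact: measurableC.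
by split => //; exact: measurable_fun_set1.
Qed.

Lemma measurable_fun_eq_wave f g u s c t : bitame f g ->
  (forall k, k != 0 -> u k = s * improper_wave f k (c * k + t)) ->
  measurable_fun [set: R] u.
Proof.
move=> tf uE; apply: measurable_fun_off0.
apply: (eq_measurable_fun (fun k => s * improper_wave f k (c * k + t))).
  by move=> k; rewrite inE => /eqP k0; rewrite uE.
by apply: measurable_funM => //; exact: measurable_improper_wave tf.
Qed.

Lemma integrable_eq_wave f g h u s c t : bitame f g -> bitame g h ->
  (forall k, 0 < k -> u k = s * improper_wave f k (c * k + t)) ->
  mu.-integrable `](0 : R), +oo[ (EFin \o u).
Proof.
move=> tf tg uE.
have iw : mu.-integrable `](0 : R), +oo[
    (fun k => s%:E * (improper_wave f k (c * k + t))%:E)%E.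
  by apply: integrableZl => //; exact: integrable_improper_wave tf tg.
apply: (eq_integrable _ _ _ _ iw) => //.
by move=> k; rewrite inE/= in_itv/= andbT => k0; rewrite uE.
Qed.

Lemma Rintegral_eq_wave f g h u s x : bitame f g -> bitame g h ->
  (forall k, 0 < k -> u k = s * improper_wave f k (- (k * x))) ->
  \int[mu]_(k in `]0, +oo[) u k = s * (pi * f x).
Proof.
move=> tf tg uE; rewrite -(Rintegral_improper_wave x tf tg) -RintegralZl//.
  by apply: eq_Rintegral => k; rewrite inE/= in_itv/= andbT => /uE.
have E k : - (k * x) = - x * k + 0 by rewrite addr0 mulNr mulrC.
apply: eq_integrable (integrable_improper_wave (- x) 0 tf tg) => //.
by move=> k _; rewrite /= E.
Qed.

(** The modulus is at most the sum of the absolute values of its two components, each below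
    [s * K * profile |k|]; the integrable profile then dominates on both half-lines. *)
Lemma L1_fourier f g h : bitame f g -> bitame g h -> L1 (fourier f).
Proof.
move=> tf tg; set s : R := (Num.sqrt (2 * pi))^-1.
have s0 : 0 <= s by rewrite invr_ge0 sqrtr_ge0.
have mRe : measurable_fun [set: R] (fun k => complex.Re (fourier f k)).
  apply: (@measurable_fun_eq_wave f g _ s 0 0 tf) => k k0.
  by rewrite (fourierE tf k0) mul0r addr0.
have mIm : measurable_fun [set: R] (fun k => complex.Im (fourier f k)).
  apply: (@measurable_fun_eq_wave f g _ s 0 (pi / 2) tf) => k k0.
  by rewrite (fourierE tf k0) mul0r add0r.
split => //.
pose N k := ComplexField.Normc.normc (fourier f k).
have NE k : N k =
    Num.sqrt (complex.Re (fourier f k) ^+ 2 + complex.Im (fourier f k) ^+ 2).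
  by rewrite /N; case: (fourier f k).
have N0 k : 0 <= N k by rewrite NE sqrtr_ge0.
have mN : measurable_fun [set: R] N.
  apply: (eq_measurable_fun _ (fun k _ => esym (NE k))).
  apply: (measurableT_comp (f := @Num.sqrt R)).
    exact: continuous_measurable_fun (@sqrt_continuous R).
  by apply: measurable_funD; exact: measurable_funX.
have [K K0 HK] := improper_wave_le_profile tf tg.
have NK k : k != 0 -> N k <= 2 * s * K * profile `|k|.
  move=> k0; rewrite NE (fourierE tf k0) (le_trans (sqrt_sqrD_le _ _))//=.
  rewrite !normrM (ger0_norm s0) -mulrDr -!mulrA [leRHS]mulrCA ler_wpM2l//.
  by rewrite mulr_natl mulr2n lerD// HK.
have bound (u : R -> R) : measurable_fun [set: R] u ->
    (forall k, 0 < k -> 0 <= u k <= 2 * s * K * profile k) ->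
    mu.-integrable `](0 : R), +oo[ (EFin \o u).
  move=> mu_ uK; apply: (@le_integrable _ _ _ mu _ _ _
    (fun k => (2 * s * K * profile k)%:E)) => //.
  - by apply/measurable_EFinP; exact: measurable_funTS.
  - move=> k /=; rewrite in_itv/= andbT => /uK/andP[u0 uk].
    by rewrite lee_fin ger0_norm// (le_trans uk)// ler_norm.
  - exact: integrable_scaled_profile.
have iN : mu.-integrable [set: R] (EFin \o N).
  apply: integrable_symmetrize => //.
    by apply: bound => // k k0; rewrite N0 -{2}(gtr0_norm k0) NK// gt_eqF.
  apply: (bound (fun k => N (- k))).
    apply: (measurableT_comp mN); exact: oppr_measurable.
  move=> k k0; rewrite N0 (le_trans (NK _ _))// ?oppr_eq0 ?gt_eqF//.
  by rewrite normrN gtr0_norm.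
move/integrableP : iN => [_]; congr (_ < _)%E; apply: eq_integral => k _.
by rewrite gee0_abs// lee_fin N0.
Qed.

(** The integrand is even off [0], so the half-lines contribute [s * (pi * f x)] each, and
    [s * (2 * pi)] is [Num.sqrt (2 * pi)]. *)
Lemma Re_inverse_fourier f g h x : bitame f g -> bitame g h ->
  \int[mu]_k complex.Re (fourier f k * cexp ('i%C * k%:C * x%:C)) =
    Num.sqrt (2 * pi) * f x.
Proof.
move=> tf tg; set s : R := (Num.sqrt (2 * pi))^-1.
have E k : k != 0 -> complex.Re (fourier f k * cexp ('i%C * k%:C * x%:C)) =
    s * improper_wave f k (- (k * x)).
  by move=> k0; rewrite (fourier_cexpE _ tf k0).
have EN k : k != 0 ->
    complex.Re (fourier f (- k) * cexp ('i%C * (- k)%:C * x%:C)) =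
    s * improper_wave f k (- (k * x)).
  by move=> k0; rewrite E ?oppr_eq0// improper_wave_neg mulNr opprK.
have lin k : - (k * x) = - x * k + 0 by rewrite addr0 mulNr mulrC.
rewrite Rintegral_symmetrize.
- rewrite (@Rintegral_eq_wave f g h _ s x tf tg) => [|k k0]; last first.
    by rewrite E// gt_eqF.
  rewrite (@Rintegral_eq_wave f g h _ s x tf tg) => [|k k0]; last first.
    by rewrite EN// gt_eqF.
  have p0 : 0 < Num.sqrt (2 * pi) :> R by rewrite sqrtr_gt0 mulr_gt0 ?pi_gt0.
  have -> : s * (pi * f x) + s * (pi * f x) = s * (2 * pi) * f x by ring.
  rewrite -{1}[2 * pi]sqr_sqrtr ?mulr_ge0 ?pi_ge0// expr2 mulKf//.
  by rewrite gt_eqF.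
- apply: (@measurable_fun_eq_wave f g _ s (- x) 0 tf) => k k0.
  by rewrite E// lin.
- apply: (@integrable_eq_wave f g h _ s (- x) 0 tf tg) => k k0.
  by rewrite E ?gt_eqF// lin.
- apply: (@integrable_eq_wave f g h _ s (- x) 0 tf tg) => k k0.
  by rewrite EN ?gt_eqF// lin.
Qed.

(** Negating [k] negates the phase, which here amounts to a shift by [- pi]: the integrand is odd
    off [0] and the half-lines cancel. *)
Lemma Im_inverse_fourier f g h x : bitame f g -> bitame g h ->
  \int[mu]_k complex.Im (fourier f k * cexp ('i%C * k%:C * x%:C)) = 0.
Proof.
move=> tf tg; set s : R := (Num.sqrt (2 * pi))^-1.
have E k : k != 0 -> complex.Im (fourier f k * cexp ('i%C * k%:C * x%:C)) =
    s * improper_wave f k (- x * k + pi / 2).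
  by move=> k0; rewrite (fourier_cexpE _ tf k0) addrC mulNr [x * k]mulrC.
have EN k : k != 0 ->
    complex.Im (fourier f (- k) * cexp ('i%C * (- k)%:C * x%:C)) =
    - s * improper_wave f k (- x * k + pi / 2).
  move=> k0; rewrite E ?oppr_eq0// improper_wave_neg.
  have -> : - (- x * - k + pi / 2) = (- x * k + pi / 2) + - pi by field.
  by rewrite (improper_waveD _ _ tf k0) cosN sinN cospi sinpi; ring.
rewrite Rintegral_symmetrize.
- have -> : \int[mu]_(k in `]0, +oo[)
      complex.Im (fourier f (- k) * cexp ('i%C * (- k)%:C * x%:C)) =
    \int[mu]_(k in `]0, +oo[)
      (-1 * complex.Im (fourier f k * cexp ('i%C * k%:C * x%:C))).
    apply: eq_Rintegral => k; rewrite inE/= in_itv/= andbT => k0.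
    by rewrite EN ?gt_eqF// E ?gt_eqF// mulN1r mulNr.
  rewrite RintegralZl//; first by rewrite mulN1r subrr.
  apply: (@integrable_eq_wave f g h _ s (- x) (pi / 2) tf tg) => k k0.
  by rewrite E// gt_eqF.
- apply: (@measurable_fun_eq_wave f g _ s (- x) (pi / 2) tf) => k k0.
  by rewrite E.
- apply: (@integrable_eq_wave f g h _ s (- x) (pi / 2) tf tg) => k k0.
  by rewrite E// gt_eqF.
- apply: (@integrable_eq_wave f g h _ (- s) (- x) (pi / 2) tf tg) => k k0.
  by rewrite EN// gt_eqF.
Qed.

Lemma fourier_inversion f g h x : bitame f g -> bitame g h ->
  (f x)%:C = inverse_fourier (fourier f) x.
Proof.
move=> tf tg; rewrite /inverse_fourier /cintegral.
rewrite (Re_inverse_fourier _ tf tg) (Im_inverse_fourier _ tf tg).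
have p0 : Num.sqrt (2 * pi) != 0 :> R.
  by rewrite gt_eqF// sqrtr_gt0 mulr_gt0 ?pi_gt0.
by simpc; rewrite mulKf.
Qed.

End fourier_inversion.

(** The first conjunct guarantees that the [lim] inside [fourier] is a genuine limit for
    [k != 0]. *)
Theorem lemma0p8 (R : realType) (f : R -> R)
  (f_C3 : class_C 3 f)
  (f_nonosc : non_oscillatory f) (f'_nonosc : non_oscillatory (f^`()%classic))
  (f_decr : very_moderate_decrease f)
  (f'_decr : very_moderate_decrease (f^`()%classic))
  (f_bnd : forall j, (j <= 3)%N -> bounded_fun (f^`(j)%classic)) :
  [/\ forall k : R, k != 0 -> cvg (truncated_fourier f k r @[r --> +oo]),
      L1 (fourier f)
    & forall x, (f x)%:C = inverse_fourier (fourier f) x].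
Proof.
have [dC3 _] := f_C3.
have dn i (x : R) : (i < 3)%N -> is_derive x 1 (f^`(i)%classic)
  (f^`(i.+1)%classic x).
  by move=> /dC3/(_ x) d; split => //; rewrite derive1nS derive1E.
have cn i : (i < 3)%N -> continuous (f^`(i)%classic).
  by move=> i3; apply: (@is_derive_continuous _ _ (f^`(i.+1)%classic)) => x;
    exact: dn.
(* One pair for each of the two integrations by parts. *)
have b0 : bitame (f^`(0)%classic) (f^`(1)%classic) :=
  bitame_intro (fun x => dn 0 x isT) (cn 1 isT) (f_bnd 0 isT) (f_bnd 1 isT)
    f_decr f_nonosc.
have b1 : bitame (f^`(1)%classic) (f^`(2)%classic) :=
  bitame_intro (fun x => dn 1 x isT) (cn 2 isT) (f_bnd 1 isT) (f_bnd 2 isT)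
    f'_decr f'_nonosc.
split.
- by move=> k k0; apply/cvg_ex; eexists; exact: truncated_fourier_cvg b0 k0.
- exact: L1_fourier b0 b1.
- by move=> x; exact: fourier_inversion b0 b1.
Qed.
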